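(* Let $V$ be a space containing a rational $4$-tuple. Then $V$ is homothetic either to a superrectangular space, or to one of the two dodecagonal spaces $\mathbb{Q}+\mathbb{Q}\tau_1$, $\mathbb{Q}+\mathbb{Q}\tau_2$, where $\tau_1=(i+1)\frac{\sqrt{3}-1}{2}$ and $\tau_2=(i-1)\frac{3-\sqrt{3}}{2}$.
   Context: A space is a $2$-dimensional $\mathbb{Q}$-vector subspace $V\subset\mathbb{C}$ containing two $\mathbb{R}$-linearly independent vectors. Spaces $V_1,V_2$ are homothetic if $V_2=\lambda V_1$ for some $\lambda\in\mathbb{C}^*$. A rational $4$-tuple in $V$ is a set of $4$ vectors of $V$ spanning $4$ distinct lines through $0$ such that for any two of them $v,w$ the argument of $w/v$ is a rational multiple of $\pi$. $V$ is superrectangular if it is homothetic to $\mathbb{Q}+\mathbb{Q}\tau$ for some root of unity $\tau$. *)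

(* Defs.v *)
From Stdlib Require Import Reals QArith Qreals.
From Coquelicot Require Import Coquelicot.
Open Scope C_scope.

Definition is_rat (r : R) : Prop := exists q : Q, r = Q2R q.

Definition Q_subspace (V : C -> Prop) : Prop :=
  V 0 /\ (forall x y, V x -> V y -> V (x + y)) /\
  (forall r x, is_rat r -> V x -> V (RtoC r * x)).

Definition Q_dim2 (V : C -> Prop) : Prop :=
  exists a b : C,
    (forall r s, is_rat r -> is_rat s -> RtoC r * a + RtoC s * b = 0 -> r = 0%R /\ s = 0%R) /\
    (forall z, V z <-> exists r s, is_rat r /\ is_rat s /\ z = RtoC r * a + RtoC s * b).

Definition R_indep (u v : C) : Prop :=
  forall r s : R, RtoC r * u + RtoC s * v = 0 -> r = 0%R /\ s = 0%R.

Definition is_space (V : C -> Prop) : Prop :=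
  Q_subspace V /\ Q_dim2 V /\ exists u v, V u /\ V v /\ R_indep u v.

Definition homothetic (V1 V2 : C -> Prop) : Prop :=
  exists l : C, l <> 0 /\ forall z, V2 z <-> exists w, V1 w /\ z = l * w.

Definition is_arg (z : C) (theta : R) : Prop :=
  z = RtoC (Cmod z) * (RtoC (cos theta) + Ci * RtoC (sin theta)).

Definition rat_arg (z : C) : Prop :=
  exists q : R, is_rat q /\ is_arg z (q * PI)%R.

Definition rational_4tuple (V : C -> Prop) (v : nat -> C) : Prop :=
  (forall i, (i < 4)%nat -> V (v i) /\ v i <> 0) /\
  (forall i j, (i < 4)%nat -> (j < 4)%nat -> i <> j ->
     ~ (exists r : R, v j = RtoC r * v i)) /\
  (forall i j, (i < 4)%nat -> (j < 4)%nat -> i <> j -> rat_arg (v j / v i)).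

Definition QQ (tau : C) : C -> Prop :=
  fun z => exists r s, is_rat r /\ is_rat s /\ z = RtoC r + RtoC s * tau.

Definition root_of_unity (tau : C) : Prop :=
  exists n : nat, (0 < n)%nat /\ Cpow tau n = 1.

Definition superrectangular (V : C -> Prop) : Prop :=
  exists tau, root_of_unity tau /\ homothetic V (QQ tau).

Definition tau1 : C := (Ci + 1) * RtoC ((sqrt 3 - 1) / 2).
Definition tau2 : C := (Ci - 1) * RtoC ((3 - sqrt 3) / 2).

(* Main.v *)
Require Import Defs.
From Stdlib Require Import Reals QArith Qreals ZArith Lra Lia.
From Coquelicot Require Import Coquelicot.
From mathcomp Require all_boot all_order all_algebra all_solvable all_field.
From mathcomp Require ring zify complex Rstruct.

(** Divide by the first vector of the tuple and let [t1], [t2], [t3] be the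
arguments of the other three. With [A = t2 + t3 - t1], [B = t1 + t3 - t2] and
[C = t1 + t2 - t3], the linear dependence over the rationals of the vectors
becomes a relation [p cos A + q cos B + r cos C = 0] with nonzero rational
[p], [q], [r] such that [p + q + r = 0], and the four lines are distinct exactly
when the three cosines are.

Let [N] be the least common order of the roots of unity [exp(iA)], [exp(iB)],
[exp(iC)]. The relation is preserved by the Galois group of the [N]-th cyclotomic
field. If [N = m d], averaging it over the conjugations that raise to the powers
[1 + t d] splits it according to the values of [u^d]. When [m] is an odd prime
dividing [d], or [m = 4] and [d] is even, each part vanishes; when [m >= 5] is a
prime not dividing [d], all parts have the same modulus, and one of them vanishes,
since otherwise one of the cosines would be [+-1/4]. A part involves at most
one of [u], [1/u] for each of the three roots of unity, so the vanishing of
a part forces two of the cosines to be equal up to sign. Otherwise [N] divides 12,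
and a direct inspection shows that either two of the cosines are equal up to
sign, or all three are in [{0, +-1/2, +-1}].

If two cosines are opposite, two vectors of the tuple are orthogonal, and adding
a third one makes the space superrectangular. In the remaining case the cosines
are [0], [+-1/2] and [+-1] in some order, and the relative sign of the
last two tells [tau1] from [tau2]. *)

Module CosineRelation.
Set Implicit Arguments. Unset Strict Implicit. Unset Printing Implicit Defensive.
Import all_boot all_order all_algebra all_solvable all_field.
Import mathcomp.algebra_tactics.ring zify complex Rstruct.
Import Order.TTheory GRing.Theory Num.Theory.
Local Open Scope ring_scope.

(** * Cyclotomic polynomials and Galois conjugates of roots of unity *)

Lemma map_poly_intr_ratr (F : numFieldType) (f : {poly int}) :
  map_poly intr f = map_poly ratr (map_poly (intr : int -> rat) f) :> {poly F}.
Proof.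
by rewrite -map_poly_comp; apply: eq_map_poly => a /=; rewrite ratr_int.
Qed.

Lemma expr_eq1_Cyclotomic (C : numFieldType) n (z : C) : (0 < n)%N ->
  (z ^+ n == 1) = has (fun d => root (map_poly intr 'Phi_d) z) (divisors n).
Proof.
move=> n_gt0; have -> : (z ^+ n == 1) = root (map_poly intr ('X^n - 1)) z.
  by rewrite rmorphB rmorph1 /= map_polyXn /root !hornerE subr_eq0.
by rewrite -prod_Cyclotomic // rmorph_prod rootE horner_prod prodf_seq_eq0.
Qed.

(** As [z] is a root of [X^n - 1], it is a root of ['Phi_d] for some [d] dividing [n]; then
    [z^d = 1], and primitivity forces [d = n]. *)
Lemma root_Cyclotomic (C : numFieldType) n (z : C) :
  n.-primitive_root z -> root (map_poly intr 'Phi_n) z.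
Proof.
move=> zP; have n_gt0 := prim_order_gt0 zP.
have: z ^+ n == 1 by rewrite (prim_expr_order zP).
rewrite expr_eq1_Cyclotomic // => /hasP[d]; rewrite -dvdn_divisors // => dn rd.
suff -> : n = d by [].
have d_gt0 : (0 < d)%N by apply: dvdn_gt0 dn.
apply/eqP; rewrite eqn_dvd dn andbT (prim_order_dvd zP) expr_eq1_Cyclotomic //.
by apply/hasP; exists d; rewrite // -dvdn_divisors.
Qed.

(** ['Phi_n] is irreducible over the rationals, being the minimal polynomial of a primitive root [w]
    in [algC]. The gcd [g] of [f] and ['Phi_n] has the root [z], so it is not constant; its cofactor
    [h] then has too small a degree to vanish at [w]. Hence [g] vanishes at [w], and ['Phi_n]
    divides [g]. *)
Lemma dvdp_Cyclotomic (C : numClosedFieldType) n (z : C) (f : {poly rat}) :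
  n.-primitive_root z ->
  root (map_poly ratr f) z = (map_poly intr 'Phi_n %| f).
Proof.
move=> zP; set P : {poly rat} := map_poly intr 'Phi_n.
have Pz : root (map_poly ratr P) z by rewrite -map_poly_intr_ratr root_Cyclotomic.
apply/idP/idP => [fz|]; last first.
  by case/dvdpP=> g ->; rewrite rmorphM rootM Pz orbT.
have [w wP] := C_prim_root_exists (prim_order_gt0 zP).
have [Q [DQ monQ] dvdQ] := minCpolyP w.
have DP : P = Q.
  apply: (@map_inj_poly _ _ (ratr : rat -> algC)); rewrite ?rmorph0 //.
    exact: fmorph_inj.
  by rewrite -DQ (minCpoly_cyclotomic wP) -map_poly_intr_ratr (Cintr_Cyclotomic wP).
have Pw : root (map_poly ratr P) w by rewrite dvdQ DP.
have P0 : P != 0 by rewrite DP monic_neq0.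
set g := gcdp f P.
have gz : root (map_poly ratr g) z by rewrite gcdp_map root_gcd fz Pz.
have /dvdpP[h Dh] : g %| P by apply: dvdp_gcdr.
have : root (map_poly ratr (h * g)) w by rewrite -Dh.
rewrite rmorphM rootM !dvdQ -DP => /orP[hP|gP]; last first.
  by apply: dvdp_trans gP (dvdp_gcdl _ _).
have h0 : h != 0 by apply: contraNneq P0 => h0; rewrite Dh h0 mul0r.
have g0 : g != 0 by apply: contraNneq P0 => g0; rewrite Dh g0 mulr0.
have := dvdp_leq h0 hP; rewrite Dh size_mul //.
have : (1 < size g)%N.
  rewrite -(size_map_poly (ratr : {rmorphism rat -> C})).
  by apply: root_size_gt1 gz; rewrite map_poly_eq0.
by case: (size g) => [|[|s]] // _; rewrite !addnS /= ltnNge leq_addr.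
Qed.

(** A root [z] of ['Phi_n] has some order [d], and by irreducibility of ['Phi_d] a primitive [d]-th
    root in [algC] is a root of ['Phi_n] too. The roots of ['Phi_n] in [algC] have order [n], so
    [d = n]. *)
Lemma prim_root_exists (C : numClosedFieldType) n :
  (0 < n)%N -> {z : C | n.-primitive_root z}.
Proof.
move=> n_gt0; apply/sigW.
have /closed_rootP[z Pz] : size (map_poly intr 'Phi_n : {poly C}) != 1%N.
  rewrite size_map_inj_poly ?size_Cyclotomic //; last exact: intr_inj.
  by rewrite eqSS -lt0n totient_gt0.
have zn : z ^+ n = 1.
  apply/eqP; rewrite expr_eq1_Cyclotomic //; apply/hasP; exists n => //.
  by rewrite -dvdn_divisors.
exists z; have [d zP dn] := prim_order_exists n_gt0 zn.
have [w wP] := C_prim_root_exists (prim_order_gt0 zP).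
have [v vP] := C_prim_root_exists n_gt0.
have : root (map_poly intr 'Phi_n) w.
  by rewrite (map_poly_intr_ratr algC) (dvdp_Cyclotomic _ wP)
    -(dvdp_Cyclotomic _ zP) -(map_poly_intr_ratr C).
rewrite (Cintr_Cyclotomic vP) (root_cyclotomic vP) => wP'.
suff <- : d = n by [].
by apply/eqP; rewrite eqn_dvd dn (prim_order_dvd wP') (prim_expr_order wP) eqxx.
Qed.

Lemma root_intr_expr (C : numClosedFieldType) n k (z : C) (f : {poly int}) :
  n.-primitive_root z -> coprime k n ->
  root (map_poly intr f) z -> root (map_poly intr f) (z ^+ k).
Proof.
move=> zP kn; rewrite (map_poly_intr_ratr C) (dvdp_Cyclotomic _ zP).
by rewrite (dvdp_Cyclotomic (z := z ^+ k) (n := n)) // prim_root_exp_coprime.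
Qed.

(** Inverses are rewritten as powers with exponents [a * (n - 1)], so that the relation says that an
    integer polynomial vanishes at the primitive root [w]. It then vanishes at the conjugate
    [w^k]. *)
Lemma relation_expr (C : numClosedFieldType) n k (p q r : int) (x y z : C) :
  (0 < n)%N -> x ^+ n = 1 -> y ^+ n = 1 -> z ^+ n = 1 -> coprime k n ->
  p%:~R * (x + x^-1) + q%:~R * (y + y^-1) + r%:~R * (z + z^-1) = 0 ->
  p%:~R * (x ^+ k + x ^- k) + q%:~R * (y ^+ k + y ^- k)
    + r%:~R * (z ^+ k + z ^- k) = 0.
Proof.
move=> n0 xn yn zn kn; have [w wP] := prim_root_exists C n0.
have pow u : u ^+ n = 1 -> {a : nat | u = w ^+ a & u^-1 = w ^+ (a * n.-1)}.
  move=> un; have [a ->] := prim_rootP wP un; exists (val a) => //.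
  have wa0 : w ^+ a != 0 by rewrite expf_neq0 // (prim_root_eq0 wP) -lt0n.
  apply: (mulfI wa0); rewrite mulfV // -exprD -mulnS prednK //.
  by rewrite mulnC exprM (prim_expr_order wP) expr1n.
have [a xa xa'] := pow x xn; have [b yb yb'] := pow y yn.
have [c zc zc'] := pow z zn.
rewrite -!exprVn xa' yb' zc' xa yb zc.
pose f : {poly int} := p *: ('X^a + 'X^(a * n.-1)) + q *: ('X^b + 'X^(b * n.-1))
  + r *: ('X^c + 'X^(c * n.-1)).
have fE u : (map_poly intr f).[u] = p%:~R * (u ^+ a + u ^+ (a * n.-1))
    + q%:~R * (u ^+ b + u ^+ (b * n.-1)) + r%:~R * (u ^+ c + u ^+ (c * n.-1)) :> C.
  by rewrite !rmorphD /= !map_polyZ !rmorphD /= !map_polyXn !hornerE.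
rewrite -fE => /rootP/(root_intr_expr wP kn)/rootP.
by rewrite fE -!exprM !(mulnC k).
Qed.

(** * Averaging the relation over Galois conjugates *)

(* The share of [c * (u + u^-1)] in the part where the [d]-th power is [w]. *)
Definition part (C : fieldType) (d : nat) (c u w : C) : C :=
  (if u ^+ d == w then c * u else 0) + (if u ^- d == w then c * u^-1 else 0).

Lemma sum_expr_unity (F : fieldType) m (v : F) :
  v ^+ m = 1 -> \sum_(t < m) v ^+ t = if v == 1 then m%:R else 0.
Proof.
move=> vm; have [->|v1] := eqVneq v 1.
  rewrite (eq_bigr (fun _ => 1)) => [|i _]; last by rewrite expr1n.
  by rewrite sumr_const card_ord.
by apply: (mulfI (_ : v - 1 != 0)); rewrite ?subr_eq0 // -subrX1 vm subrr mulr0.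
Qed.

Lemma unity_neq0 (F : fieldType) m (v : F) : (0 < m)%N -> v ^+ m = 1 -> v != 0.
Proof.
move=> m0 vm; apply/eqP => v0; have := oner_neq0 F.
by rewrite -vm v0 expr0n eqn0Ngt m0 eqxx.
Qed.

(** Since [u^(1 + t d) = u (u^d)^t], the sum is [u] times a geometric series whose ratio [u^d / w]
    is an [m]-th root of unity. *)
Lemma sum_expr_char (F : fieldType) m d (u w : F) :
  (0 < m)%N -> u ^+ (m * d) = 1 -> w ^+ m = 1 ->
  \sum_(t < m) w ^- t * u ^+ (1 + t * d)
    = m%:R * (if u ^+ d == w then u else 0).
Proof.
move=> m0 um wm; have w0 := unity_neq0 m0 wm.
under eq_bigr => t _ do
  rewrite addnC exprD expr1 mulnC exprM -exprVn mulrA -exprMn.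
rewrite -mulr_suml sum_expr_unity; last first.
  by rewrite exprMn -exprM exprVn wm invr1 mul1r mulnC.
have -> : (w^-1 * u ^+ d == 1) = (u ^+ d == w).
  by rewrite -(inj_eq (mulfI w0)) mulVKf // mulr1.
by case: ifP => _; rewrite ?mulr0 ?mul0r.
Qed.

Lemma sum_part (F : fieldType) m d (c u w : F) :
  (0 < m)%N -> u ^+ (m * d) = 1 -> w ^+ m = 1 ->
  \sum_(t < m) w ^- t * (c * (u ^+ (1 + t * d) + u ^- (1 + t * d)))
    = m%:R * part d c u w.
Proof.
move=> m0 um wm; rewrite /part.
have um' : u^-1 ^+ (m * d) = 1 by rewrite exprVn um invr1.
have := sum_expr_char m0 um' wm; have := sum_expr_char m0 um wm.
rewrite exprVn => e1 e2.
transitivity (c * (\sum_(t < m) w ^- t * u ^+ (1 + t * d))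
    + c * (\sum_(t < m) w ^- t * u^-1 ^+ (1 + t * d))).
  rewrite !mulr_sumr -big_split; apply: eq_bigr => t _ /=.
  by rewrite exprVn mulrDr mulrDr !(mulrCA c).
by rewrite e1 e2 !(mulrCA c) -mulrDr; do 2!case: ifP => _; rewrite ?mulr0.
Qed.

Lemma relation_sum_part (C : numClosedFieldType) m d (p q r : int) (x y z w : C) :
  (0 < m)%N -> x ^+ (m * d) = 1 -> y ^+ (m * d) = 1 -> z ^+ (m * d) = 1 ->
  w ^+ m = 1 ->
  \sum_(t < m) w ^- t * (p%:~R * (x ^+ (1 + t * d) + x ^- (1 + t * d))
      + q%:~R * (y ^+ (1 + t * d) + y ^- (1 + t * d))
      + r%:~R * (z ^+ (1 + t * d) + z ^- (1 + t * d)))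
  = m%:R * (part d p%:~R x w + part d q%:~R y w + part d r%:~R z w).
Proof.
move=> m0 xm ym zm wm; rewrite [RHS]mulrDr [X in _ = X + _]mulrDr -!sum_part // -!big_split.
by apply: eq_bigr => t _ /=; rewrite !mulrDr.
Qed.

(** Each [1 + t d] is prime to [m d], because a prime dividing both would divide [d] and hence 1. So
    every conjugate in the average vanishes. *)
Lemma part_sum_eq0 (C : numClosedFieldType) m d (p q r : int) (x y z w : C) :
  (0 < m)%N -> (0 < d)%N -> (forall l, prime l -> l %| m -> l %| d)%N ->
  x ^+ (m * d) = 1 -> y ^+ (m * d) = 1 -> z ^+ (m * d) = 1 -> w ^+ m = 1 ->
  p%:~R * (x + x^-1) + q%:~R * (y + y^-1) + r%:~R * (z + z^-1) = 0 ->
  part d p%:~R x w + part d q%:~R y w + part d r%:~R z w = 0.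
Proof.
move=> m0 d0 md xm ym zm wm rel.
have m0' : m%:R != 0 :> C by rewrite pnatr_eq0 -lt0n.
apply: (mulfI m0'); rewrite -relation_sum_part // mulr0 big1 // => t _.
rewrite (relation_expr (n := m * d)) ?mulr0 ?muln_gt0 ?m0 //.
rewrite /coprime; apply/eqP/eqP; rewrite eqn_leq gcdn_gt0 andbT.
rewrite leqNgt; apply/negP => /pdiv_prime; set l := pdiv _ => lP.
have := pdiv_dvd (gcdn (1 + t * d) (m * d)); rewrite -/l dvdn_gcd => /andP[l1].
rewrite Euclid_dvdM // => lmd.
have ld : (l %| d)%N by case/orP: lmd => //; apply: md.
by move: l1; rewrite dvdn_addl ?dvdn_mull // dvdn1 => /eqP l1; rewrite l1 in lP.
Qed.

Lemma unity_norm (C : numClosedFieldType) m (v : C) :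
  (0 < m)%N -> v ^+ m = 1 -> `|v| = 1.
Proof.
by move=> m0 vm; apply/eqP; rewrite -(pexpr_eq1 m0) // -normrX vm normr1.
Qed.

(** Two indices [t < m] with [m] dividing [1 + t d] coincide, and for all other [t] the conjugate
    relation holds. The average thus has at most one nonzero term, and [w] enters it only through a
    factor of modulus 1. *)
Lemma part_sum_norm (C : numClosedFieldType) m d (p q r : int) (x y z w w' : C) :
  prime m -> (0 < d)%N -> ~~ (m %| d)%N ->
  x ^+ (m * d) = 1 -> y ^+ (m * d) = 1 -> z ^+ (m * d) = 1 ->
  w ^+ m = 1 -> w' ^+ m = 1 ->
  p%:~R * (x + x^-1) + q%:~R * (y + y^-1) + r%:~R * (z + z^-1) = 0 ->
  `|part d p%:~R x w + part d q%:~R y w + part d r%:~R z w|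
    = `|part d p%:~R x w' + part d q%:~R y w' + part d r%:~R z w'|.
Proof.
move=> mP d0 md xm ym zm wm wm' rel; have m0 := prime_gt0 mP.
have m0' : `|m%:R| != 0 :> C by rewrite normr_eq0 pnatr_eq0 -lt0n.
apply: (mulfI m0'); rewrite -!normrM -!relation_sum_part //.
pose G (t : nat) := p%:~R * (x ^+ (1 + t * d) + x ^- (1 + t * d))
      + q%:~R * (y ^+ (1 + t * d) + y ^- (1 + t * d))
      + r%:~R * (z ^+ (1 + t * d) + z ^- (1 + t * d)).
have G0 (t : 'I_m) : ~~ (m %| 1 + t * d)%N -> G t = 0.
  move=> mt; apply: (relation_expr (n := m * d)); rewrite ?muln_gt0 ?m0 //.
  rewrite coprimeMr coprime_sym prime_coprime // mt /=.
  by rewrite coprime_sym /coprime addnC gcdnMDl gcdn1.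
have uniq_t0 (a b : 'I_m) :
    (m %| 1 + a * d)%N -> (m %| 1 + b * d)%N -> (a <= b)%N.
  move=> ma mb; rewrite leqNgt; apply/negP => ltba.
  have := dvdn_sub ma mb; rewrite subnDl -mulnBl Euclid_dvdM // (negbTE md) orbF.
  by rewrite gtnNdvd ?subn_gt0 // (leq_ltn_trans (leq_subr _ _)).
have [t0 t0P|none] := pickP (fun t : 'I_m => (m %| 1 + t * d)%N); last first.
  by rewrite !big1 // => t _; rewrite -/(G t) G0 ?none ?mulr0.
have sumE v : v ^+ m = 1 ->
    `|\sum_(t < m) v ^- t * G t| = `|G t0|.
  move=> vm; rewrite (bigD1 t0) //= big1 => [|t tt0].
    by rewrite addr0 normrM normfV normrX (unity_norm m0 vm) expr1n invr1 mul1r.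
  rewrite G0 ?mulr0 //; apply: contra tt0 => mt.
  by rewrite -val_eqE eqn_leq /= !uniq_t0.
by rewrite (sumE _ wm) (sumE _ wm').
Qed.

(** * Integrality: a root of unity never has real part 1/4 or -1/4 *)

Lemma unity_integral (C : numClosedFieldType) n (z : C) :
  (0 < n)%N -> z ^+ n = 1 -> integralOver (intr : int -> C) z.
Proof.
move=> n0 zn; exists ('X^n - 1); first by rewrite monicXnsubC.
by rewrite rmorphB rmorph1 /= map_polyXn /root !hornerE zn subrr.
Qed.

Lemma unity_add_inv_int (C : numClosedFieldType) n (z : C) (a : rat) :
  (0 < n)%N -> z ^+ n = 1 -> z + z^-1 = ratr a -> a \is a Num.int.
Proof.
move=> n0 zn za; have zn' : z^-1 ^+ n = 1 by rewrite exprVn zn invr1.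
have [f f_monic] := integral_add (unity_integral n0 zn) (unity_integral n0 zn').
rewrite za (map_poly_intr_ratr C) fmorph_root => fa.
have : ratr a \in Aint.
  apply: (@root_monic_Aint (map_poly intr f)).
  - by rewrite (map_poly_intr_ratr algC) fmorph_root.
  - exact: monic_map.
  - by apply/polyOverP => i; rewrite coef_map /= rpred_int.
by move/(Cint_rat_Aint (Crat_rat a)); rewrite Cint_rat.
Qed.

(** As [z^-1] is the conjugate of [z], the sum is real. It would be 1/2 or -1/2, which is rational
    but not an integer, against [unity_add_inv_int]. *)
Lemma unity_add_inv_norm (C : numClosedFieldType) n (z : C) :
  (0 < n)%N -> z ^+ n = 1 -> 2 * `|z + z^-1| != 1.
Proof.
move=> n0 zn; apply/eqP => zz.
have zE : z^* = z^-1.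
  rewrite invC_norm (unity_norm n0 zn) expr1n invr1 mul1r //.
have : (2 * (z + z^-1)) ^+ 2 = 1.
  rewrite -{1}zE exprMn.
  have <- : (z + z^*) * (z + z^*)^* = (z + z^*) ^+ 2.
    by rewrite rmorphD /= conjCK [z^* + z]addrC.
  by rewrite -normCK -exprMn {1}zE zz expr1n.
have n2 : 2 != 0 :> C by rewrite pnatr_eq0.
move/eqP; rewrite sqrf_eq1 => /orP[] /eqP e.
  suff: (2^-1 : rat) \is a Num.int by [].
  apply: (unity_add_inv_int n0 zn).
  by apply: (mulfI n2); rewrite e fmorphV rmorph_nat mulfV.
suff: (- 2^-1 : rat) \is a Num.int by [].
apply: (unity_add_inv_int n0 zn).
by apply: (mulfI n2); rewrite e rmorphN fmorphV rmorph_nat mulrN mulfV.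
Qed.

(** * Vanishing sums of two or three terms *)

Lemma part_cases (C : fieldType) d (c u w : C) : w != w^-1 ->
  part d c u w = 0 \/ exists2 v, v = u \/ v = u^-1 & part d c u w = c * v.
Proof.
rewrite /part => ww; case: eqP => [uw|_]; last first.
  by rewrite add0r; case: eqP => _; [right; exists u^-1; [right|] | left].
right; exists u; first by left.
case: eqP => [uw'|_]; last by rewrite addr0.
by case/eqP: ww; rewrite -{2}uw uw'.
Qed.

Lemma part_char (C : fieldType) d (c u : C) :
  u ^+ d != u ^- d -> part d c u (u ^+ d) = c * u.
Proof. by rewrite /part eqxx eq_sym => /negPf ->; rewrite addr0. Qed.

Lemma part_neg (C : fieldType) d (c u w : C) :
  u ^+ d != w -> u ^- d != w -> part d c u w = 0.
Proof. by rewrite /part => /negPf -> /negPf ->; rewrite addr0. Qed.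

Lemma part1 (C : fieldType) d (c u : C) :
  u ^+ d = 1 -> part d c u 1 = c * (u + u^-1).
Proof. by rewrite /part => ->; rewrite invr1 eqxx mulrDr. Qed.

(** The moduli give [p = q] or [p = -q], and the latter would make [r] zero. *)
Lemma norm_int_eq (C : numClosedFieldType) (p q r : int) (x y : C) :
  r != 0 -> p + q + r = 0 -> `|x| = 1 -> `|y| = 1 ->
  `|p%:~R * x| = `|q%:~R * y| -> p = q.
Proof.
move=> r0 pqr x1 y1; rewrite !normrM x1 y1 !mulr1 -!intr_norm.
move/intr_inj/eqP; rewrite eqr_norm2 => /orP[/eqP //|/eqP pq].
by move: pqr r0; rewrite pq addNr add0r => ->; rewrite eqxx.
Qed.

Lemma two_term (C : numClosedFieldType) (p q r : int) (x y : C) :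
  p != 0 -> r != 0 -> p + q + r = 0 -> `|x| = 1 -> `|y| = 1 ->
  p%:~R * x + q%:~R * y = 0 -> x = - y.
Proof.
move=> p0 r0 pqr x1 y1 e.
have pq : p = q.
  apply: norm_int_eq r0 pqr x1 y1 _.
  by move/eqP: e; rewrite addr_eq0 => /eqP ->; rewrite normrN.
move/eqP: e; rewrite -pq -mulrDr mulf_eq0 intr_eq0 (negPf p0) /= addr_eq0.
by move/eqP.
Qed.

(* [p + q + r = 0] makes this the equality case of the triangle inequality. *)
Lemma three_term (C : numClosedFieldType) (p q r : int) (x y z : C) :
  p != 0 -> q != 0 -> r != 0 -> p + q + r = 0 ->
  `|x| = 1 -> `|y| = 1 -> `|z| = 1 ->
  p%:~R * x + q%:~R * y + r%:~R * z = 0 -> x = y.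
Proof.
move=> p0 q0 r0 pqr x1 y1 z1 e.
have inv (u : C) : `|u| = 1 -> u^* = u^-1.
  by move=> u1; rewrite invC_norm u1 expr1n invr1 mul1r.
have nz (u : C) : `|u| = 1 -> u != 0.
  by move=> u1; rewrite -normr_eq0 u1 oner_eq0.
have := congr1 (fun u => u^*) e.
rewrite /= !rmorphD !rmorphM /= !rmorph_int rmorph0 !inv // => e'.
have rE : r%:~R = - p%:~R - q%:~R :> C.
  by rewrite -!rmorphN -rmorphD; congr _%:~R; lia.
rewrite !rE in e e'.
have eA : p%:~R * (x - z) = - (q%:~R * (y - z)).
  by apply/eqP; rewrite -subr_eq0 opprK -e; apply/eqP; ring.
(* The conjugate relation, multiplied by [- x y z], reads [p (x - z) y + q (y - z) x = 0]; the
   original one, [p (x - z) + q (y - z) = 0], eliminates [q]. *)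
have : p%:~R * (x - z) * (x - y) = 0.
  have : p%:~R * (x - z) * y + q%:~R * (y - z) * x = 0.
    have -> : 0 = - (x * y * z) * 0 :> C by rewrite mulr0.
    by rewrite -e'; field; rewrite !nz.
  have -> : q%:~R * (y - z) = - (p%:~R * (x - z)) by rewrite eA opprK.
  by move=> h; rewrite -[RHS]oppr0 -h; ring.
move/eqP; rewrite !mulf_eq0 intr_eq0 (negPf p0) !subr_eq0 /=.
case/orP => /eqP // xz; move/eqP: eA; rewrite xz subrr mulr0 eq_sym oppr_eq0.
by rewrite mulf_eq0 intr_eq0 (negPf q0) subr_eq0 => /eqP.
Qed.

(** As [x^d] is not real, the part consists of [p x] and at most one term from each of [y] and [z].
    One term alone cannot vanish, two terms make [x] opposite to the other root or its inverse, and
    three make [x] equal to [y] or [y^-1]; squaring absorbs the sign. *)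
Lemma part_vanish (C : numClosedFieldType) d (p q r : int) (x y z : C) :
  p != 0 -> q != 0 -> r != 0 -> p + q + r = 0 ->
  `|x| = 1 -> `|y| = 1 -> `|z| = 1 -> x ^+ d != x ^- d ->
  part d p%:~R x (x ^+ d) + part d q%:~R y (x ^+ d) + part d r%:~R z (x ^+ d) = 0 ->
  (x + x^-1) ^+ 2 = (y + y^-1) ^+ 2 \/ (x + x^-1) ^+ 2 = (z + z^-1) ^+ 2.
Proof.
move=> p0 q0 r0 pqr x1 y1 z1 xd; rewrite part_char //.
have x0 : x != 0 by rewrite -normr_eq0 x1 oner_eq0.
have inv1 (u v : C) : `|u| = 1 -> v = u \/ v = u^-1 -> `|v| = 1.
  by move=> u1 [] ->; rewrite ?normfV u1 ?invr1.
have same (u v : C) : v = u \/ v = u^-1 -> u + u^-1 = v + v^-1.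
  by case=> ->; rewrite // invrK addrC.
have prp : p + r + q = 0 by rewrite addrAC.
have [->|[y' yy' ->]] := part_cases d q%:~R y xd;
  have [->|[z' zz' ->]] := part_cases d r%:~R z xd; rewrite ?addr0.
- by move/eqP; rewrite mulf_eq0 intr_eq0 (negPf p0) (negPf x0).
- move=> e; right; rewrite (same _ _ zz').
  rewrite (two_term p0 q0 prp x1 (inv1 _ _ z1 zz') e).
  by rewrite invrN -opprD sqrrN.
- move=> e; left; rewrite (same _ _ yy').
  rewrite (two_term p0 r0 pqr x1 (inv1 _ _ y1 yy') e).
  by rewrite invrN -opprD sqrrN.
- move=> e; left; rewrite (same _ _ yy').
  by rewrite (three_term p0 q0 r0 pqr x1 _ _ e) // (inv1 _ _ _ yy', inv1 _ _ _ zz').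
Qed.

(** * Reduction of the common order *)

(** For [u = exp(i a)] this is [4 cos^2 a], so equal values mean cosines equal up to sign. *)
Definition sqcos (C : fieldType) (u : C) : C := (u + u^-1) ^+ 2.

Definition two_equal (T : Type) (a b c : T) : Prop := [\/ a = b, a = c | b = c].

Lemma common_order (R : pzRingType) n (x y z : R) :
  (0 < n)%N -> x ^+ n = 1 -> y ^+ n = 1 -> z ^+ n = 1 ->
  {m | (0 < m)%N /\ [/\ x ^+ m = 1, y ^+ m = 1 & z ^+ m = 1]
   & forall k, x ^+ k = 1 -> y ^+ k = 1 -> z ^+ k = 1 -> (m %| k)%N}.
Proof.
move=> n0 xn yn zn.
have: exists m, [&& (0 < m)%N, x ^+ m == 1, y ^+ m == 1 & z ^+ m == 1].
  by exists n; rewrite n0 xn yn zn !eqxx.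
case/ex_minnP => m /and4P[m0 /eqP xm /eqP ym /eqP zm] min_m.
exists m => // k xk yk zk; rewrite /dvdn -[_ == _]negbK -lt0n; apply/negP => km.
have := min_m (k %% m)%N; rewrite km !expr_mod // xk yk zk !eqxx => /(_ isT).
by rewrite leqNgt ltn_pmod.
Qed.

(** If the [d]-th powers of [x], [y], [z] were all real, [2 d] would be a common exponent, although
    [m d] with [m > 2] is the least. So [part_vanish] applies to one whose power is not real. *)
Lemma vanishing_parts (C : numClosedFieldType) m d (p q r : int) (x y z : C) :
  (2 < m)%N -> (0 < d)%N ->
  p != 0 -> q != 0 -> r != 0 -> p + q + r = 0 ->
  x ^+ (m * d) = 1 -> y ^+ (m * d) = 1 -> z ^+ (m * d) = 1 ->
  (forall k, x ^+ k = 1 -> y ^+ k = 1 -> z ^+ k = 1 -> (m * d %| k)%N) ->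
  (forall w : C, w ^+ m = 1 ->
    part d p%:~R x w + part d q%:~R y w + part d r%:~R z w = 0) ->
  two_equal (sqcos x) (sqcos y) (sqcos z).
Proof.
move=> m2 d0 p0 q0 r0 pqr xm ym zm Nmin vanish.
have N0 : (0 < m * d)%N by rewrite muln_gt0 d0 andbT (ltn_trans _ m2).
have x1 := unity_norm N0 xm; have y1 := unity_norm N0 ym.
have z1 := unity_norm N0 zm.
have wm (u : C) : u ^+ (m * d) = 1 -> (u ^+ d) ^+ m = 1.
  by rewrite -exprM mulnC.
have real (u : C) : `|u| = 1 -> u ^+ d = u ^- d -> u ^+ (2 * d) = 1.
  move=> u1 ud; rewrite mul2n -addnn exprD {1}ud mulVf //.
  by rewrite expf_neq0 // -normr_eq0 u1 oner_eq0.
have [xd|/eqP xd] := eqVneq (x ^+ d) (x ^- d); last first.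
  have [] := part_vanish p0 q0 r0 pqr x1 y1 z1 (introN eqP xd) (vanish _ (wm _ xm)).
    by move=> ?; apply: Or31.
  by move=> ?; apply: Or32.
have [yd|/eqP yd] := eqVneq (y ^+ d) (y ^- d); last first.
  have qrp : q + r + p = 0 by rewrite -pqr; ring.
  have := vanish _ (wm _ ym); rewrite -addrA addrC => van.
  have [] := part_vanish q0 r0 p0 qrp y1 z1 x1 (introN eqP yd) van.
    by move=> ?; apply: Or33.
  by move=> ?; apply: Or31.
have [zd|/eqP zd] := eqVneq (z ^+ d) (z ^- d); last first.
  have rpq : r + p + q = 0 by rewrite -pqr; ring.
  have := vanish _ (wm _ zm); rewrite addrC addrA => van.
  have [] := part_vanish r0 p0 q0 rpq z1 x1 y1 (introN eqP zd) van.
    by move=> ?; apply: Or32.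
  by move=> ?; apply: Or33.
have := Nmin (2 * d)%N (real _ x1 xd) (real _ y1 yd) (real _ z1 zd).
by rewrite dvdn_pmul2r // => /(dvdn_leq (m := 2) isT); rewrite leqNgt m2.
Qed.

Lemma unity_prime_order (R : nzRingType) l k (w : R) :
  prime l -> w ^+ l = 1 -> w != 1 -> w ^+ k = 1 -> (l %| k)%N.
Proof.
move=> lP wl w1 wk.
have [m wm] := prim_order_exists (prime_gt0 lP) wl.
case/primeP: lP => _ h /h /orP[] /eqP mE; last first.
  by rewrite -mE (prim_order_dvd wm) wk.
by case/eqP: w1; rewrite -[w]expr1 -mE (prim_expr_order wm).
Qed.

(** By equality of moduli, one vanishing part suffices. With [w = x^d], the part at [w^2] gets
    nothing from [x] or [z], so it vanishes unless [y^d] is [w^2] or [w^-2]. In that case the parts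
    at [w], [w^2] and 1 have moduli [|p|], [|q|] and [|r (z + z^-1)|]; hence [p = q], [r = -2 p] and
    [2 |z + z^-1| = 1], which is impossible. *)
Lemma nonvanishing_parts (C : numClosedFieldType) l d (p q r : int) (x y z : C) :
  (4 < l)%N -> prime l -> (0 < d)%N ->
  p != 0 -> q != 0 -> r != 0 -> p + q + r = 0 ->
  x ^+ (l * d) = 1 -> y ^+ (l * d) = 1 -> z ^+ (l * d) = 1 ->
  (forall w w' : C, w ^+ l = 1 -> w' ^+ l = 1 ->
    `|part d p%:~R x w + part d q%:~R y w + part d r%:~R z w|
     = `|part d p%:~R x w' + part d q%:~R y w' + part d r%:~R z w'|) ->
  x ^+ d != 1 -> z ^+ d = 1 ->
  forall w : C, w ^+ l = 1 ->
    part d p%:~R x w + part d q%:~R y w + part d r%:~R z w = 0.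
Proof.
move=> l4 lP d0 p0 q0 r0 pqr xl yl zl S_norm xd zd.
have N0 : (0 < l * d)%N by rewrite muln_gt0 d0 prime_gt0.
have x1 := unity_norm N0 xl; have y1 := unity_norm N0 yl.
pose S w := part d p%:~R x w + part d q%:~R y w + part d r%:~R z w.
set w := x ^+ d in xd.
have wl : w ^+ l = 1 by rewrite -exprM mulnC.
have w0 : w != 0 by apply: unity_neq0 (prime_gt0 lP) wl.
(* As [w] has prime order at least 5, the elements 1, [w], [w^-1], [w^2], [w^-2] are distinct. *)
have wk k : (0 < k < 5)%N -> w ^+ k != 1.
  case/andP=> k0 k4; apply/eqP => /(unity_prime_order lP wl xd).
  by move/(dvdn_leq k0) => lk; have := leq_trans l4 (leq_trans lk k4); rewrite ltnn.
suff [v vl Sv] : exists2 v, v ^+ l = 1 & S v = 0.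
  move=> u ul; apply/eqP; rewrite -normr_eq0 (S_norm _ v) //.
  by rewrite -/(S v) Sv normr0.
have ww k : w ^+ k.+1 = w ^+ k * w by rewrite exprSr.
have w2l : (w ^+ 2) ^+ l = 1 by rewrite exprAC wl expr1n.
have w1 : w^-1 != 1 by rewrite invr_eq1.
have w2 : w ^+ 2 != 1 by apply: wk.
have w2' : w ^- 2 != 1 by rewrite invr_eq1.
have ww2 : w != w ^+ 2.
  by rewrite expr2 -{1}[w]mulr1 (inj_eq (mulfI w0)) eq_sym.
have ww2' : w^-1 != w ^+ 2.
  by rewrite -(inj_eq (mulfI w0)) mulfV // -exprS eq_sym wk.
have w4 : w ^+ 2 != (w ^+ 2)^-1.
  rewrite -(inj_eq (mulfI (expf_neq0 2 w0))) mulfV ?(expf_neq0 2 w0) //.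
  by rewrite -exprD wk.
have ww2'' : w != w ^- 2 by rewrite -(inj_eq invr_inj) invrK.
have part_x2 : part d p%:~R x (w ^+ 2) = 0 by rewrite part_neg.
have part_x1 : part d p%:~R x 1 = 0 by rewrite part_neg.
have part_z (v : C) : v != 1 -> part d r%:~R z v = 0.
  by move=> v1; rewrite part_neg // zd ?invr1 eq_sym.
have [yw|yw] := boolP ((y ^+ d == w ^+ 2) || (y ^- d == w ^+ 2)); last first.
  exists (w ^+ 2) => //; rewrite /S part_x2 part_z // addr0 add0r.
  by case/norP: yw => *; rewrite part_neg.
have [y2|[y' yy' y2]] := part_cases d q%:~R y w4.
  by exists (w ^+ 2) => //; rewrite /S part_x2 part_z // y2 !addr0.
have ydE : y ^+ d = w ^+ 2 \/ y ^+ d = w ^- 2.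
  by case/orP: yw => /eqP yw; [left | right; rewrite -yw invrK].
have part_y1 : part d q%:~R y 1 = 0.
  by rewrite part_neg //; case: ydE => ->; rewrite ?invrK.
have part_yw : part d q%:~R y w = 0.
  by rewrite part_neg //; case: ydE => ->; rewrite ?invrK // eq_sym.
have Sw : S w = p%:~R * x.
  rewrite /S part_yw part_z // !addr0 part_char // -/w.
  by rewrite -(inj_eq (mulfI w0)) mulfV // -expr2.
have Sw2 : S (w ^+ 2) = q%:~R * y' by rewrite /S part_x2 part_z // y2 addr0 add0r.
have S1 : S 1 = r%:~R * (z + z^-1) by rewrite /S part_x1 part_y1 part1 // !add0r.
have y'1 : `|y'| = 1 by case: yy' => ->; rewrite ?normfV y1 ?invr1.
have pq : p = q.
  apply: norm_int_eq r0 pqr x1 y'1 _.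
  by rewrite -Sw -Sw2; apply: S_norm.
have rE : r = - (p * 2) by rewrite -pq in pqr; lia.
have := S_norm w 1 wl (expr1n _ _); rewrite -/(S w) -/(S 1) Sw S1 rE.
rewrite rmorphN rmorphM /= mulNr normrN -mulrA !normrM x1 mulr1.
have np0 : `|p%:~R| != 0 :> C by rewrite normr_eq0 intr_eq0.
rewrite -{1}[`|p%:~R|]mulr1 => /(mulfI np0)/esym/eqP.
by rewrite normr_nat (negPf (unity_add_inv_norm N0 zl)).
Qed.

(** * Roots of unity of order dividing 12 *)

Definition small (C : fieldType) (u : C) : Prop :=
  [\/ sqcos u = 0, sqcos u = 1 | sqcos u = 4].

(** Raising to the power 7 multiplies [u] by [u^6], which is 1 or -1; on cosines this conjugation
    changes the sign of [sqrt 3]. The values come from factoring [u^6 - 1] and [u^6 + 1] as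
    polynomials in [u^2]. *)
Lemma unity12_cases (C : fieldType) (u : C) : u ^+ 12 = 1 ->
  small u /\ u ^+ 7 + u ^- 7 = u + u^-1 \/
  sqcos u = 3 /\ u ^+ 7 + u ^- 7 = - (u + u^-1).
Proof.
move=> u12; have u0 : u != 0 by apply: unity_neq0 u12.
have sqE (a b : C) : u ^+ 2 = a -> a != 0 -> a + 2 + a^-1 = b -> sqcos u = b.
  by move=> ua a0 <-; rewrite -ua /sqcos; field.
have sqE' (b : C) : u ^+ 4 + (2 - b) * u ^+ 2 + 1 = 0 -> sqcos u = b.
  move=> h; rewrite /sqcos -[b]addr0 -(mul0r (u ^- 2)) -h; field.
  by rewrite u0.
have : (u ^+ 6) ^+ 2 = 1 by rewrite -exprM.
move/eqP; rewrite sqrf_eq1 => /orP[] /eqP u6.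
  left; rewrite exprSr u6 mul1r; split=> //.
  have : (u ^+ 2 - 1) * (u ^+ 4 + (2 - 1) * u ^+ 2 + 1) = 0.
    have -> : 0 = u ^+ 6 - 1 by rewrite u6 subrr.
    by ring.
  move/eqP; rewrite mulf_eq0 subr_eq0 => /orP[] /eqP h.
    by apply: Or33; apply: (sqE 1); rewrite ?oner_neq0 // invr1; ring.
  by apply: Or32; apply: sqE'.
have u7 : u ^+ 7 + u ^- 7 = - (u + u^-1).
  by rewrite exprSr u6 mulN1r invrN -opprD.
have : (u ^+ 2 + 1) * (u ^+ 4 + (2 - 3) * u ^+ 2 + 1) = 0.
  have -> : 0 = u ^+ 6 + 1 by rewrite u6 addNr.
  by ring.
move/eqP; rewrite mulf_eq0 => /orP[] /eqP h; last by right; split=> //; apply: sqE'.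
have c0 : u + u^-1 = 0.
  by rewrite -(mul0r u^-1) -h; field.
left; rewrite u7 c0 oppr0; split=> //; apply: Or31.
by rewrite /sqcos c0 expr0n.
Qed.

(** If exactly one cosine is a multiple of [sqrt 3], subtracting the conjugate relation isolates it
    and makes it zero, a contradiction. If at least two are, their squares agree. *)
Lemma relation_unity12 (C : numClosedFieldType) (p q r : int) (x y z : C) :
  p != 0 -> q != 0 -> r != 0 ->
  x ^+ 12 = 1 -> y ^+ 12 = 1 -> z ^+ 12 = 1 ->
  p%:~R * (x + x^-1) + q%:~R * (y + y^-1) + r%:~R * (z + z^-1) = 0 ->
  two_equal (sqcos x) (sqcos y) (sqcos z) \/ [/\ small x, small y & small z].
Proof.
move=> p0 q0 r0 x12 y12 z12 rel.
have := relation_expr (k := 7) (n := 12) isT x12 y12 z12 isT rel.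
have n2 : 2 != 0 :> C by rewrite pnatr_eq0.
have n3 : 3 != 0 :> C by rewrite pnatr_eq0.
have lone (s : int) (u : C) : s != 0 -> sqcos u = 3 ->
    2 * (s%:~R * (u + u^-1)) = 0 -> False.
  move=> s0 u3 /eqP; rewrite !mulf_eq0 intr_eq0 (negPf n2) (negPf s0) /= => /eqP e.
  by move: u3; rewrite /sqcos e expr0n => /eqP; rewrite eq_sym (negPf n3).
case: (unity12_cases x12) => [[sx ->]|[sx ->]];
  case: (unity12_cases y12) => [[sy ->]|[sy ->]];
  case: (unity12_cases z12) => [[sz ->]|[sz ->]] rel'.
- by right.
- by case: (lone r z) => //; rewrite -[RHS](subrr 0) -{1}rel -rel'; ring.
- by case: (lone q y) => //; rewrite -[RHS](subrr 0) -{1}rel -rel'; ring.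
- by left; apply: Or33; rewrite sy sz.
- by case: (lone p x) => //; rewrite -[RHS](subrr 0) -{1}rel -rel'; ring.
- by left; apply: Or32; rewrite sx sz.
- by left; apply: Or31; rewrite sx sy.
- by left; apply: Or31; rewrite sx sy.
Qed.

(** * The relation between three cosines *)

Lemma prime_parts (C : numClosedFieldType) l d (p q r : int) (x y z : C) :
  (4 < l)%N -> prime l -> (0 < d)%N -> ~~ (l %| d)%N ->
  p != 0 -> q != 0 -> r != 0 -> p + q + r = 0 ->
  x ^+ (l * d) = 1 -> y ^+ (l * d) = 1 -> z ^+ (l * d) = 1 ->
  p%:~R * (x + x^-1) + q%:~R * (y + y^-1) + r%:~R * (z + z^-1) = 0 ->
  x ^+ d != 1 -> z ^+ d = 1 ->
  forall w : C, w ^+ l = 1 ->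
    part d p%:~R x w + part d q%:~R y w + part d r%:~R z w = 0.
Proof.
move=> l4 lP d0 ld p0 q0 r0 pqr xl yl zl rel; apply: (nonvanishing_parts l4) => //.
by move=> w w' wl wl'; apply: (part_sum_norm lP d0 ld xl yl zl wl wl' rel).
Qed.

Lemma dvdn12 n : (0 < n)%N -> (forall l, prime l -> l %| n -> l <= 4)%N ->
  ~~ (9 %| n)%N -> ~~ (8 %| n)%N -> (n %| 12)%N.
Proof.
move=> n0 small9 n9 n8; apply/dvdn_partP => // l; rewrite mem_primes.
case/and3P=> lP _ ln; rewrite p_part.
have : l \in [:: 2; 3]%N.
  have := small9 l lP ln; move: lP => {ln}.
  by case: l => [|[|[|[|[|l]]]]].
rewrite !inE => /orP[] /eqP ->.
  apply: (@dvdn_trans (2 ^ 2)) => //; apply: dvdn_exp2l.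
  by rewrite leqNgt -pfactor_dvdn.
apply: (@dvdn_trans (3 ^ 1)) => //; apply: dvdn_exp2l.
by rewrite leqNgt -pfactor_dvdn.
Qed.

Theorem cosine_relation (C : numClosedFieldType) n (p q r : int) (x y z : C) :
  (0 < n)%N -> x ^+ n = 1 -> y ^+ n = 1 -> z ^+ n = 1 ->
  p != 0 -> q != 0 -> r != 0 -> p + q + r = 0 ->
  p%:~R * (x + x^-1) + q%:~R * (y + y^-1) + r%:~R * (z + z^-1) = 0 ->
  two_equal (sqcos x) (sqcos y) (sqcos z) \/ [/\ small x, small y & small z].
Proof.
move=> n0 xn yn zn p0 q0 r0 pqr rel.
have [N [N0 [xN yN zN]] Nmin] := common_order n0 xn yn zn.
(* The case where the only prime [l] that divides [m] also divides [d]; it serves for [m] an odd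
   prime and for [m = 4]. *)
have repeated m d l : prime l -> (2 < m)%N -> N = (m * d)%N -> (l %| d)%N ->
    (forall k, prime k -> k %| m -> k = l)%N ->
    two_equal (sqcos x) (sqcos y) (sqcos z).
  move=> lP m2 NE ld ml; move: N0 xN yN zN Nmin; rewrite NE muln_gt0.
  case/andP=> m0 d0 xN yN zN Nmin.
  apply: (vanishing_parts m2 d0 p0 q0 r0 pqr xN yN zN Nmin) => w wm.
  apply: (part_sum_eq0 m0 d0 _ xN yN zN wm rel) => k kP km.
  by rewrite (ml k kP km).
have [/hasP[l]|no_large] := boolP (has (leq 5) (primes N)).
  rewrite mem_primes => /and3P[lP _ /dvdnP[d]]; rewrite mulnC => NE l4.
  have lprime k : prime k -> (k %| l)%N -> k = l.
    by move=> kP; rewrite dvdn_prime2 // => /eqP.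
  left; have [ld|ld] := boolP (l %| d)%N.
    by apply: (repeated l d l) => //; rewrite (ltn_trans _ l4).
  have d0 : (0 < d)%N by case: d ld {NE} => //; rewrite dvdn0.
  move: N0 xN yN zN Nmin; rewrite NE => N0 xN yN zN Nmin.
  apply: (vanishing_parts _ d0 p0 q0 r0 pqr xN yN zN Nmin) => [|w wl].
    by rewrite (ltn_trans _ l4).
  have zero p' q' r' x' y' z' := @prime_parts C l d p' q' r' x' y' z' l4 lP d0 ld.
  (* If all three [d]-th powers are 1, the minimality of [N] fails. If none is, the part at 1 is
     empty, so all parts vanish. Otherwise a permutation puts a power other than 1 first and a power
     equal to 1 last. *)
  have [xd|xd] := eqVneq (x ^+ d) 1; have [yd|yd] := eqVneq (y ^+ d) 1;
    have [zd|zd] := eqVneq (z ^+ d) 1.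
  - have := dvdn_leq d0 (Nmin d xd yd zd).
    by rewrite -{2}[d]mul1n leq_pmul2r // leqNgt (ltn_trans _ l4).
  - rewrite -[RHS](zero r p q z x y _ _ _ _ zN xN yN _ zd yd w wl) //; first ring.
    by rewrite -pqr; ring.
    by rewrite -rel; ring.
  - rewrite -[RHS](zero q p r y x z _ _ _ _ yN xN zN _ yd zd w wl) //; first ring.
    by rewrite -pqr; ring.
    by rewrite -rel; ring.
  - rewrite -[RHS](zero r q p z y x _ _ _ _ zN yN xN _ zd xd w wl) //; first ring.
    by rewrite -pqr; ring.
    by rewrite -rel; ring.
  - rewrite -[RHS](zero p q r x y z _ _ _ _ xN yN zN _ xd zd w wl) //.
  - rewrite -[RHS](zero p r q x z y _ _ _ _ xN zN yN _ xd yd w wl) //; first ring.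
    by rewrite -pqr; ring.
    by rewrite -rel; ring.
  - rewrite -[RHS](zero p q r x y z _ _ _ _ xN yN zN _ xd zd w wl) //.
  - apply/eqP; rewrite -normr_eq0.
    rewrite (part_sum_norm lP d0 ld xN yN zN wl (expr1n _ _) rel).
    by rewrite !part_neg ?invr_eq1 // !addr0 normr0.
have [/dvdnP[d]|n9] := boolP (9 %| N)%N.
  rewrite (mulnA d 3 3) mulnC => NE; left; apply: (repeated 3 (d * 3) 3)%N => //.
    by rewrite dvdn_mull.
  by move=> k kP; rewrite dvdn_prime2 // => /eqP.
(* Here [m = 4] replaces the prime 2, since [vanishing_parts] requires [m > 2]; this is why 8 has to
   divide [N]. *)
have [/dvdnP[d]|n8] := boolP (8 %| N)%N.
  rewrite (mulnA d 2 4) mulnC => NE; left; apply: (repeated 4 (d * 2) 2)%N => //.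
    by rewrite dvdn_mull.
  by move=> k kP; rewrite (@Euclid_dvdX 2 2 k) // dvdn_prime2 // => /andP[/eqP].
have /dvdnP[e NE] : (N %| 12)%N.
  apply: dvdn12 => // l lP lN; rewrite leqNgt; apply: contra no_large => l4.
  by apply/hasP; exists l => //; rewrite mem_primes lP N0.
have to12 (u : C) : u ^+ N = 1 -> u ^+ 12 = 1.
  by move=> uN; rewrite NE mulnC exprM uN expr1n.
exact: relation_unity12 p0 q0 r0 (to12 _ xN) (to12 _ yN) (to12 _ zN) rel.
Qed.

(** * Transfer to the real numbers *)

(* Coquelicot's complex numbers carry no MathComp structure. *)
Definition toRi (u : C) : complex R := complex.Complex u.1 u.2.

Lemma toRi_pow u n : toRi (Cpow u n) = toRi u ^+ n.
Proof. by elim: n => // n IHn; rewrite exprS -IHn. Qed.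

Lemma toRi_add_inv u n : (0 < n)%N -> Cpow u n = RtoC 1 ->
  toRi u + (toRi u)^-1 = real_complex R (2 * u.1).
Proof.
move=> n0 un; have un' : toRi u ^+ n = 1 by rewrite -toRi_pow un.
have -> : (toRi u)^-1 = ((toRi u)^*)%R.
  by rewrite invC_norm (unity_norm n0 un') expr1n invr1 mul1r.
case: u {un un'} => a b; apply/eqP; rewrite eq_complex /= subrr eqxx andbT.
by rewrite mulrDl !mul1r.
Qed.

Lemma IZR_intr (k : Z) : {i : int | IZR k = i%:~R :> R}.
Proof.
case: k => [|k|k]; first by exists 0.
  by exists (Posz (nat_of_pos k)); rewrite IZRposE INRE.
exists (- Posz (nat_of_pos k)).
by rewrite -Pos2Z.opp_pos opp_IZR IZRposE INRE rmorphN.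
Qed.

Lemma sqcos_toRi u n : (0 < n)%N -> Cpow u n = RtoC 1 ->
  sqcos (toRi u) = real_complex R ((2 * u.1) ^+ 2).
Proof. by move=> n0 un; rewrite /sqcos (toRi_add_inv n0 un) rmorphXn. Qed.

Lemma cosine_relation_R (n : nat) (p q r : Z) (x y z : C) :
  (0 < n)%coq_nat -> Cpow x n = RtoC 1 -> Cpow y n = RtoC 1 -> Cpow z n = RtoC 1 ->
  p <> Z0 -> q <> Z0 -> r <> Z0 -> Z.add (Z.add p q) r = Z0 ->
  Rplus (Rplus (Rmult (IZR p) x.1) (Rmult (IZR q) y.1)) (Rmult (IZR r) z.1) = IZR 0 ->
  two_equal (Rmult x.1 x.1) (Rmult y.1 y.1) (Rmult z.1 z.1) \/
  forall u, u = x \/ u = y \/ u = z ->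
    u.1 = IZR 0 \/ Rmult (Rplus u.1 u.1) (Rplus u.1 u.1) = IZR 1
    \/ Rmult u.1 u.1 = IZR 1.
Proof.
move=> /ssrnat.ltP n0 xn yn zn p0 q0 r0 pqr; rewrite !RplusE !RmultE => rel.
have [p' pE] := IZR_intr p; have [q' qE] := IZR_intr q.
have [r' rE] := IZR_intr r.
have nz k (i : int) : IZR k = i%:~R :> R -> k <> Z0 -> i != 0.
  by move=> e k0; apply/eqP => i0; apply: k0; apply: eq_IZR; rewrite e i0.
have pow u : Cpow u n = RtoC 1 -> toRi u ^+ n = 1 by move=> un; rewrite -toRi_pow un.
have pqr' : p' + q' + r' = 0.
  apply: (@intr_inj R); rewrite !rmorphD /= -pE -qE -rE.
  by rewrite -!RplusE -!plus_IZR pqr.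
have rel' : p'%:~R * (toRi x + (toRi x)^-1) + q'%:~R * (toRi y + (toRi y)^-1)
    + r'%:~R * (toRi z + (toRi z)^-1) = 0.
  rewrite (toRi_add_inv n0 xn) (toRi_add_inv n0 yn) (toRi_add_inv n0 zn).
  rewrite -!(rmorph_int (real_complex R)) -!rmorphM -!rmorphD /= -pE -qE -rE.
  by rewrite !(mulrCA _ 2) -!mulrDr rel mulr0.
have := cosine_relation n0 (pow x xn) (pow y yn) (pow z zn)
  (nz _ _ pE p0) (nz _ _ qE q0) (nz _ _ rE r0) pqr' rel'.
rewrite /small (sqcos_toRi n0 xn) (sqcos_toRi n0 yn) (sqcos_toRi n0 zn).
have two : 2 != 0 :> R by rewrite pnatr_eq0.
have four : 4 != 0 :> R by rewrite pnatr_eq0.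
have simp (a b : R) :
    real_complex R ((2 * a) ^+ 2) = real_complex R ((2 * b) ^+ 2) -> Rmult a a = Rmult b b.
  move/complexI; rewrite !exprMn !RmultE -!expr2 -natrX; exact: mulfI.
case=> [eq2|[sx sy sz]].
  left; case: eq2 => /simp; [exact: Or31 | exact: Or32 | exact: Or33].
have sm (a : R) : [\/ real_complex R ((2 * a) ^+ 2) = 0,
    real_complex R ((2 * a) ^+ 2) = 1 | real_complex R ((2 * a) ^+ 2) = 4] ->
    a = IZR 0 \/ Rmult (Rplus a a) (Rplus a a) = IZR 1 \/ Rmult a a = IZR 1.
  have -> : Rplus a a = 2 * a by rewrite mulr_natl mulr2n.
  rewrite !RmultE -!expr2.
  case=> [| |]; rewrite -?(rmorph0 (real_complex R)) -?(rmorph1 (real_complex R))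
    -?(rmorph_nat (real_complex R) 4) => /complexI.
  - move/eqP; rewrite expf_eq0 /= => /eqP e; left.
    by apply: (mulfI two); rewrite e mulr0.
  - by right; left.
  - rewrite exprMn -natrX -{2}[4]mulr1 => /(mulfI four); by right; right.
by right=> u [->|[->|->]]; apply: sm.
Qed.
End CosineRelation.

Local Open Scope C_scope.

(** * Rational numbers and complex roots of unity *)

Lemma is_rat_plus r s : is_rat r -> is_rat s -> is_rat (r + s)%R.
Proof. intros [p ->] [q ->]; exists (p + q)%Q; now rewrite Q2R_plus. Qed.

Lemma is_rat_mult r s : is_rat r -> is_rat s -> is_rat (r * s)%R.
Proof. intros [p ->] [q ->]; exists (p * q)%Q; now rewrite Q2R_mult. Qed.

Lemma is_rat_opp r : is_rat r -> is_rat (- r)%R.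
Proof. intros [p ->]; exists (- p)%Q; now rewrite Q2R_opp. Qed.

Lemma is_rat_minus r s : is_rat r -> is_rat s -> is_rat (r - s)%R.
Proof. intros Hr Hs; apply is_rat_plus; [|apply is_rat_opp]; assumption. Qed.

Lemma is_rat_div r s : is_rat r -> is_rat s -> s <> 0%R -> is_rat (r / s)%R.
Proof.
  intros [p ->] [q ->] Hq; exists (p / q)%Q; rewrite Q2R_div; [reflexivity|].
  intros E; apply Hq; rewrite (Qeq_eqR _ _ E); unfold Q2R; simpl; lra.
Qed.

Lemma is_rat_IZR k : is_rat (IZR k).
Proof. exists (inject_Z k); unfold Q2R; simpl; field. Qed.

#[local] Hint Resolve is_rat_plus is_rat_mult is_rat_opp is_rat_minus
  is_rat_div is_rat_IZR : rat.

Lemma is_rat_frac r : is_rat r ->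
  exists (a : Z) (b : positive), r = (IZR a / IZR (Zpos b))%R.
Proof. intros [[a b] ->]; exists a, b; reflexivity. Qed.

Lemma common_denominator p q r : is_rat p -> is_rat q -> is_rat r ->
  exists (k : R) (p' q' r' : Z), k <> 0%R /\
    IZR p' = (k * p)%R /\ IZR q' = (k * q)%R /\ IZR r' = (k * r)%R.
Proof.
  intros Hp Hq Hr.
  destruct (is_rat_frac _ Hp) as (a & d & ->), (is_rat_frac _ Hq) as (b & e & ->),
    (is_rat_frac _ Hr) as (c & f & ->).
  assert (Hd : IZR (Zpos d) <> 0%R) by now apply not_0_IZR.
  assert (He : IZR (Zpos e) <> 0%R) by now apply not_0_IZR.
  assert (Hf : IZR (Zpos f) <> 0%R) by now apply not_0_IZR.
  exists (IZR (Zpos d) * IZR (Zpos e) * IZR (Zpos f))%R,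
    (a * Zpos e * Zpos f)%Z, (b * Zpos d * Zpos f)%Z, (c * Zpos d * Zpos e)%Z.
  rewrite !mult_IZR; repeat split; try (field; auto).
  repeat apply Rmult_integral_contrapositive_currified; auto.
Qed.

Lemma C_eq_iff (u v : C) : u = v <-> Re u = Re v /\ Im u = Im v.
Proof.
  destruct u, v; unfold Re, Im; simpl; split.
  - intros E; injection E; auto.
  - intros [-> ->]; reflexivity.
Qed.

Lemma RtoC_neq0 r : r <> 0%R -> RtoC r <> 0.
Proof. intros H E; apply H; now apply RtoC_inj. Qed.

Lemma Cconj_neq0 (u : C) : u <> 0 -> Cconj u <> 0.
Proof.
  intros H E; apply H; rewrite <- (Cconj_conj u), E; apply C_eq_iff; simpl; lra.
Qed.

Lemma Cmult_integral (u v : C) : u * v = 0 -> u = 0 \/ v = 0.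
Proof.
  intros E; destruct (Ceq_dec u 0) as [|H]; [now left|right].
  replace v with (/ u * (u * v)) by (field; auto); rewrite E; ring.
Qed.

Lemma Cminus_eq0 (u v : C) : u - v = 0 -> u = v.
Proof. intros E; replace u with (u - v + v) by ring; rewrite E; ring. Qed.

Lemma Cconj_RtoC r : Cconj (RtoC r) = RtoC r.
Proof. apply C_eq_iff; simpl; lra. Qed.

Lemma root_of_unity_unit x : root_of_unity x -> x * Cconj x = 1.
Proof.
  intros (n & Hn & E).
  assert (Hm : (Cmod x ^ n = 1)%R) by (rewrite <- Cmod_pow, E; apply Cmod_1).
  assert (H1 : Cmod x = 1%R).
  { destruct (Rtotal_order (Cmod x) 1) as [H|[H|H]]; auto; exfalso.
    - assert (Cmod x ^ n < 1)%R; [|lra].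
      apply pow_lt_1_compat; [split; [apply Cmod_ge_0|auto]|auto].
    - assert (1 < Cmod x ^ n)%R; [|lra].
      apply Rlt_pow_R1; auto. }
  rewrite <- Cmod2_conj, H1; apply C_eq_iff; simpl; lra.
Qed.

Lemma root_of_unity_conj x : root_of_unity x -> root_of_unity (Cconj x).
Proof.
  intros (n & Hn & E); exists n; split; auto.
  rewrite <- Cpow_conj, E; apply C_eq_iff; simpl; lra.
Qed.

Lemma root_of_unity_mult x y :
  root_of_unity x -> root_of_unity y -> root_of_unity (x * y).
Proof.
  intros (n & Hn & E) (m & Hm & F); exists (n * m)%nat; split; [nia|].
  rewrite Cpow_mult_l, Cpow_mult_r, E, Nat.mul_comm, Cpow_mult_r, F.
  now rewrite !Cpow_1_l, Cmult_1_l.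
Qed.

Lemma root_of_unity_opp x : root_of_unity x -> root_of_unity (- x).
Proof.
  intros H; replace (- x) with (- (1) * x) by ring.
  apply root_of_unity_mult; auto; exists 2%nat; split; [lia|simpl; ring].
Qed.

Lemma Cinv_neq0 (u : C) : u <> 0 -> / u <> 0.
Proof.
  intros H E; apply (RtoC_neq0 1); [lra|].
  rewrite <- (Cinv_r u H), E; ring.
Qed.

(** * Collinearity and rational bases *)

(** This says that [u * Cconj w] is real: collinearity over the reals as a polynomial identity, with
    no scalar to exhibit. *)
Definition parallel (u w : C) : Prop := u * Cconj w = Cconj u * w.

Lemma parallel_real (u w : C) : u <> 0 -> parallel u w -> exists r : R, w = RtoC r * u.
Proof.
  intros Hu E; exists (Re (w / u)).
  assert (Hr : Im (w / u) = 0%R).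
  { assert (E' : w / u = Cconj (w / u)).
    { rewrite Cdiv_conj by auto; unfold parallel in E.
      pose proof (Cconj_neq0 u Hu).
      replace (Cconj w) with (/ u * (u * Cconj w)) by (field; auto).
      rewrite E; field; auto. }
    pose proof (f_equal Im E') as H; rewrite im_conj in H; lra. }
  replace (RtoC (Re (w / u))) with (w / u)
    by (apply C_eq_iff; split; [reflexivity|exact Hr]).
  field; auto.
Qed.

(** Cramer's rule in the given basis [e1], [e2]. A zero determinant would make [u] and [w] parallel,
    because [u * Cconj w - Cconj u * w] is the determinant times the same expression in [e1],
    [e2]. *)
Lemma span_basis (V : C -> Prop) (u w : C) :
  is_space V -> V u -> V w -> ~ parallel u w ->
  forall z, V z <-> exists r s, is_rat r /\ is_rat s /\ z = RtoC r * u + RtoC s * w.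
Proof.
  intros [(_ & Vadd & Vscal) [(e1 & e2 & _ & He) _]] Hu Hw Hp z.
  split; [|intros (r & s & Hr & Hs & ->); auto].
  intros Hz; apply He in Hu, Hw, Hz.
  destruct Hu as (r0 & s0 & Hr0 & Hs0 & ->), Hw as (r1 & s1 & Hr1 & Hs1 & ->),
    Hz as (a & b & Ha & Hb & ->).
  assert (HD : (r0 * s1 - r1 * s0)%R <> 0%R).
  { intros E; apply Hp; unfold parallel.
    rewrite !Cplus_conj, !Cmult_conj, !Cconj_RtoC.
    apply Cminus_eq0.
    transitivity (RtoC (r0 * s1 - r1 * s0)%R * (e1 * Cconj e2 - Cconj e1 * e2)).
    - rewrite RtoC_minus, !RtoC_mult; ring.
    - rewrite E; ring. }
  exists ((a * s1 - b * r1) / (r0 * s1 - r1 * s0))%R,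
    ((b * r0 - a * s0) / (r0 * s1 - r1 * s0))%R.
  repeat split; auto 6 with rat.
  apply RtoC_neq0 in HD as HD'.
  rewrite !RtoC_div, !RtoC_minus, !RtoC_mult in * by auto; field; auto.
Qed.

Lemma homothetic_basis (V : C -> Prop) (u w : C) :
  is_space V -> V u -> V w -> u <> 0 -> ~ parallel u w -> homothetic V (QQ (w / u)).
Proof.
  intros HV Hu Hw Hu0 Hp.
  exists (/ u); split; [now apply Cinv_neq0|]; intros z; split.
  - intros (r & s & Hr & Hs & ->); exists (RtoC r * u + RtoC s * w); split.
    + apply (span_basis V u w); auto; exists r, s; auto.
    + field; auto.
  - intros (v & Hv & ->); apply (span_basis V u w) in Hv; auto.
    destruct Hv as (r & s & Hr & Hs & ->); exists r, s; repeat split; auto.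
    field; auto.
Qed.

(** * Four lines encoded by three roots of unity, and symmetries of the encoding *)

(* The lines of [u1], [u2], [u3] make with that of [u0] the angles
   [(arg y + arg z) / 2], [(arg x + arg z) / 2], [(arg x + arg y) / 2]. *)
Definition config (V : C -> Prop) (x y z : C) : Prop :=
  root_of_unity x /\ root_of_unity y /\ root_of_unity z /\
  exists u0 u1 u2 u3 : C,
    (V u0 /\ u0 <> 0) /\ (V u1 /\ u1 <> 0) /\ (V u2 /\ u2 <> 0) /\ (V u3 /\ u3 <> 0) /\
    u1 * Cconj u0 = y * z * (Cconj u1 * u0) /\
    u2 * Cconj u0 = x * z * (Cconj u2 * u0) /\
    u3 * Cconj u0 = x * y * (Cconj u3 * u0).

Definition distinct_Re (x y z : C) : Prop :=
  Re x <> Re y /\ Re x <> Re z /\ Re y <> Re z.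

Lemma config_swap_yz V x y z : config V x y z -> config V x z y.
Proof.
  intros (Hx & Hy & Hz & u0 & u1 & u2 & u3 & H0 & H1 & H2 & H3 & E1 & E2 & E3).
  do 3 (split; auto); exists u0, u1, u3, u2; do 4 (split; auto).
  rewrite E1, E2, E3; repeat split; ring.
Qed.

Lemma config_swap_xy V x y z : config V x y z -> config V y x z.
Proof.
  intros (Hx & Hy & Hz & u0 & u1 & u2 & u3 & H0 & H1 & H2 & H3 & E1 & E2 & E3).
  do 3 (split; auto); exists u0, u2, u1, u3; do 4 (split; auto).
  rewrite E1, E2, E3; repeat split; ring.
Qed.

Lemma config_swap_xz V x y z : config V x y z -> config V z y x.
Proof. intros H; apply config_swap_xy, config_swap_yz, config_swap_xy, H. Qed.

(** The vectors stay the same, as only the products of two of the roots enter the equations. *)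
Lemma config_opp V x y z : config V x y z -> config V (- x) (- y) (- z).
Proof.
  intros (Hx & Hy & Hz & u0 & u1 & u2 & u3 & H0 & H1 & H2 & H3 & E1 & E2 & E3).
  do 3 (split; [now apply root_of_unity_opp|]).
  exists u0, u1, u2, u3; do 4 (split; auto).
  rewrite E1, E2, E3; repeat split; ring.
Qed.

Lemma Cmult_cancel_unit (k u v : C) : k <> 0 -> k * u = k * v -> u = v.
Proof.
  intros Hk E; replace u with (/ k * (k * u)) by (field; auto).
  rewrite E; field; auto.
Qed.

(* Exchanging [u0] with [u1] and [u2] with [u3]. *)
Lemma config_conj_yz V x y z : config V x y z -> config V x (Cconj y) (Cconj z).
Proof.
  intros (Hx & Hy & Hz & u0 & u1 & u2 & u3 & H0 & H1 & H2 & H3 & E1 & E2 & E3).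
  apply root_of_unity_unit in Hy as Ey; apply root_of_unity_unit in Hz as Ez.
  split; [auto|]; do 2 (split; [now apply root_of_unity_conj|]).
  exists u1, u0, u3, u2; do 4 (split; auto).
  assert (E1' : u0 * Cconj u1 = Cconj y * Cconj z * (Cconj u0 * u1)).
  { apply (f_equal Cconj) in E1; rewrite !Cmult_conj, !Cconj_conj in E1.
    transitivity (Cconj u1 * u0); [ring|rewrite E1; ring]. }
  assert (Hk : u0 * Cconj u0 <> 0).
  { apply Cmult_neq_0; [tauto|apply Cconj_neq0; tauto]. }
  split; [exact E1'|]; split; apply (Cmult_cancel_unit _ _ _ Hk).
  - transitivity (u3 * Cconj u0 * (u0 * Cconj u1)); [ring|].
    rewrite E3, E1'.
    transitivity (y * Cconj y * (x * Cconj z * (Cconj u3 * u0 * (Cconj u0 * u1)))); [ring|].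
    rewrite Ey; ring.
  - transitivity (u2 * Cconj u0 * (u0 * Cconj u1)); [ring|].
    rewrite E2, E1'.
    transitivity (z * Cconj z * (x * Cconj y * (Cconj u2 * u0 * (Cconj u0 * u1)))); [ring|].
    rewrite Ez; ring.
Qed.

Lemma config_conj_xz V x y z : config V x y z -> config V (Cconj x) y (Cconj z).
Proof. intros H; apply config_swap_xy, config_conj_yz, config_swap_xy, H. Qed.

(** On the unit circle, [(x - y) (x y - 1)] is [x y] times the difference of [x + x^-1] and
    [y + y^-1]. *)
Lemma unit_Re_eq (x y : C) : x * Cconj x = 1 -> y * Cconj y = 1 ->
  Re x = Re y -> x = y \/ x * y = 1.
Proof.
  intros Hx Hy E.
  assert (H : x + Cconj x = y + Cconj y) by (apply C_eq_iff; simpl in *; unfold Re in *; lra).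
  destruct (Cmult_integral (x - y) (x * y - 1)) as [F|F].
  - transitivity (x * y * (x + Cconj x - (y + Cconj y))); [|rewrite H; ring].
    transitivity (x * x * y + (x * Cconj x) * y - x * y * y - (y * Cconj y) * x); [|ring].
    rewrite Hx, Hy; ring.
  - left; now apply Cminus_eq0.
  - right; now apply Cminus_eq0.
Qed.

Lemma unit_mult_eq1 (x y : C) : x * Cconj x = 1 -> x * y = 1 -> Re x = Re y.
Proof.
  intros Hx E; rewrite <- (re_conj x).
  replace (Cconj x) with y; auto.
  transitivity (x * Cconj x * y); [rewrite Hx; ring|].
  transitivity (x * y * Cconj x); [ring|rewrite E; ring].
Qed.

(** * Linear dependence and the shape of the space *)

(** The factors [d] and [e] encode the lines of [u1] and [u] relative to [u0]. Thus [d <> 1] makes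
    [u0], [u1] a basis, [e <> 1] gives [b <> 0], and [e <> d] gives [a <> 0]. The last equation
    results from inserting [u] into its own line equation. *)
Lemma third_vector (V : C -> Prop) (u0 u1 u d e : C) :
  is_space V -> V u0 -> V u1 -> V u -> u0 <> 0 -> u1 <> 0 -> u <> 0 ->
  u1 * Cconj u0 = d * (Cconj u1 * u0) -> u * Cconj u0 = e * (Cconj u * u0) ->
  d <> 1 -> e <> 1 -> e <> d ->
  exists a b : R, is_rat a /\ is_rat b /\ a <> 0%R /\ b <> 0%R /\
    u = RtoC a * u0 + RtoC b * u1 /\
    RtoC a * (1 - e) = RtoC b * (e - d) * Cconj (u1 / u0).
Proof.
  intros HV V0 V1 Vu H0 H1 Hu E1 E Hd He Hed.
  pose proof (Cconj_neq0 _ H0) as H0'; pose proof (Cconj_neq0 _ H1) as H1'.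
  assert (Hp : ~ parallel u0 u1).
  { intros P; apply Hd; unfold parallel in P.
    apply (Cmult_cancel_unit (Cconj u1 * u0)); [now apply Cmult_neq_0|].
    rewrite Cmult_comm, <- E1, Cmult_comm, <- P; ring. }
  apply (span_basis V u0 u1) in Vu; auto.
  destruct Vu as (a & b & Ha & Hb & ->).
  assert (F : RtoC a * (1 - e) = RtoC b * (e - d) * Cconj (u1 / u0)).
  { rewrite !Cplus_conj, !Cmult_conj, !Cconj_RtoC in E.
    rewrite Cdiv_conj by auto.
    apply (Cmult_cancel_unit (u0 * Cconj u0)); [now apply Cmult_neq_0|].
    transitivity ((RtoC a * u0 + RtoC b * u1) * Cconj u0 - RtoC b * (u1 * Cconj u0)
       - e * (RtoC a * Cconj u0 * u0)); [ring|].
    rewrite E, E1; field; auto. }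
  exists a, b; repeat split; auto.
  - intros ->; destruct (Req_dec b 0) as [->|Hb0]; [apply Hu; ring|].
    apply Hed, Cminus_eq0.
    apply (Cmult_cancel_unit (RtoC b * Cconj (u1 / u0))).
    + apply Cmult_neq_0; [now apply RtoC_neq0|apply Cconj_neq0].
      apply Cmult_neq_0; auto; now apply Cinv_neq0.
    + transitivity (RtoC b * (e - d) * Cconj (u1 / u0)); [ring|].
      rewrite <- F; ring.
  - intros ->; destruct (Req_dec a 0) as [->|Ha0]; [apply Hu; ring|].
    apply He; symmetry; apply Cminus_eq0.
    apply (Cmult_cancel_unit (RtoC a)); [now apply RtoC_neq0|].
    rewrite F; ring.
Qed.

Lemma config_products_neq V x y z : config V x y z -> distinct_Re x y z ->
  x * y <> 1 /\ x * z <> 1 /\ y * z <> 1 /\ x <> y /\ x <> z /\ y <> z /\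
  x <> 0 /\ y <> 0 /\ z <> 0.
Proof.
  intros (Hx & Hy & Hz & _) (Dxy & Dxz & Dyz).
  apply root_of_unity_unit in Hx, Hy, Hz.
  assert (nz : forall u : C, u * Cconj u = 1 -> u <> 0).
  { intros u E ->; apply (RtoC_neq0 1); [lra|]; rewrite <- E; ring. }
  repeat split; auto; try (intros ->; now auto);
    intros E; apply unit_mult_eq1 in E; auto.
Qed.

Lemma Re_add_conj (u : C) : u + Cconj u = RtoC (2 * Re u).
Proof. apply C_eq_iff; simpl; unfold Re; lra. Qed.

Lemma unit_sub_mult (x z : C) : x * Cconj x = 1 -> z * Cconj z = 1 ->
  (1 - x * z) * (x - z) = x * z * RtoC (2 * Re z - 2 * Re x).
Proof.
  intros Hx Hz; rewrite RtoC_minus, <- !Re_add_conj.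
  transitivity (x * z * z + x * (z * Cconj z) - x * x * z - z * (x * Cconj x)); [|ring].
  rewrite Hx, Hz; ring.
Qed.

(** Expanding [u2] and [u3] in the basis [u0], [u1] gives two equations, from which
    [Cconj (u1 / u0)] is eliminated by cross multiplication. What remains is
    [a d (Re z - Re x) = b c (Re y - Re x)], with coefficients [p = b c - a d], [q = - b c],
    [r = a d] after regrouping. *)
Lemma config_relation V x y z : is_space V -> config V x y z -> distinct_Re x y z ->
  exists p q r : R, is_rat p /\ is_rat q /\ is_rat r /\
    p <> 0%R /\ q <> 0%R /\ r <> 0%R /\ (p + q + r = 0)%R /\
    (p * Re x + q * Re y + r * Re z = 0)%R.
Proof.
  intros HV HC HD.
  destruct (config_products_neq _ _ _ _ HC HD) as
    (Nxy & Nxz & Nyz & Dxy & Dxz & Dyz & X0 & Y0 & Z0).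
  destruct HC as (Hx & Hy & Hz & u0 & u1 & u2 & u3 &
    [V0 H0] & [V1 H1] & [V2 H2] & [V3 H3] & E1 & E2 & E3).
  apply root_of_unity_unit in Hx, Hy, Hz.
  destruct (third_vector V u0 u1 u2 (y * z) (x * z)) as
    (a & b & Ha & Hb & Na & Nb & _ & F2); auto.
  { intros E; apply Dxy; apply (Cmult_cancel_unit z); auto.
    rewrite Cmult_comm, E; ring. }
  destruct (third_vector V u0 u1 u3 (y * z) (x * y)) as
    (c & d & Hc & Hd & Nc & Nd & _ & F3); auto.
  { intros E; apply Dxz; apply (Cmult_cancel_unit y); auto.
    rewrite Cmult_comm, E; ring. }
  set (s := Cconj (u1 / u0)) in *.
  assert (Hs : s <> 0).
  { apply Cconj_neq0, Cmult_neq_0; auto; now apply Cinv_neq0. }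
  assert (E : (a * d * (Re z - Re x) = b * c * (Re y - Re x))%R).
  { apply RtoC_inj.
    apply (Cmult_cancel_unit (2 * s * (x * y * z))).
    { repeat apply Cmult_neq_0; auto; apply RtoC_neq0; lra. }
    transitivity (RtoC a * RtoC d * s * y * ((1 - x * z) * (x - z))).
    { rewrite unit_sub_mult by auto; rewrite !RtoC_mult, !RtoC_minus, !RtoC_mult; ring. }
    transitivity (RtoC b * RtoC c * s * z * ((1 - x * y) * (x - y))).
    2: { rewrite unit_sub_mult by auto; rewrite !RtoC_mult, !RtoC_minus, !RtoC_mult; ring. }
    transitivity ((RtoC a * (1 - x * z)) * (RtoC d * (x * y - y * z) * s)); [ring|].
    rewrite <- F3, F2; ring. }
  destruct HD as (Rxy & Rxz & Ryz).
  assert (Nad : (a * d)%R <> 0%R) by now apply Rmult_integral_contrapositive_currified.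
  assert (Nbc : (b * c)%R <> 0%R) by now apply Rmult_integral_contrapositive_currified.
  exists (b * c - a * d)%R, (- (b * c))%R, (a * d)%R.
  do 3 (split; [auto with rat|]); split; [|split; [now apply Ropp_neq_0_compat|]].
  - intros F; replace (a * d)%R with (b * c)%R in E by lra.
    apply Rmult_eq_reg_l in E; auto; lra.
  - split; auto; split; lra.
Qed.

(** The components [a u0] and [b u1] of [u3] serve as [u] and [v]. This choice absorbs the unknown
    lengths, so that the ratio depends on the roots of unity alone. *)
Lemma config_ratio V x y z : is_space V -> config V x y z -> distinct_Re x y z ->
  exists u v : C, V u /\ V v /\ u <> 0 /\ v / u = z * (1 - x * y) / (x - z).
Proof.
  intros HV HC HD.
  destruct (config_products_neq _ _ _ _ HC HD) as
    (Nxy & Nxz & Nyz & Dxy & Dxz & Dyz & X0 & Y0 & Z0).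
  destruct HC as (_ & _ & _ & u0 & u1 & _ & u3 &
    [V0 H0] & [V1 H1] & _ & [V3 H3] & E1 & _ & E3).
  destruct (third_vector V u0 u1 u3 (y * z) (x * y)) as
    (a & b & Ha & Hb & Na & Nb & _ & F); auto.
  { intros E; apply Dxz; apply (Cmult_cancel_unit y); auto.
    rewrite Cmult_comm, E; ring. }
  pose proof (Cconj_neq0 _ H0) as H0'.
  apply RtoC_neq0 in Na; apply RtoC_neq0 in Nb.
  assert (Hxz : x - z <> 0) by (intros E; apply Dxz, Cminus_eq0, E).
  exists (RtoC a * u0), (RtoC b * u1).
  destruct HV as [(_ & _ & Vs) _]; repeat split; auto.
  { now apply Cmult_neq_0. }
  assert (E1' : u1 / u0 = y * z * Cconj (u1 / u0)).
  { rewrite Cdiv_conj by auto.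
    replace u1 with (u1 * Cconj u0 / Cconj u0) at 1 by (field; auto).
    rewrite E1; field; auto. }
  apply (Cmult_cancel_unit (RtoC a * (x - z))); [now apply Cmult_neq_0|].
  transitivity (RtoC b * (x - z) * (u1 / u0)); [field; auto|].
  rewrite E1'.
  transitivity (z * (RtoC b * (x * y - y * z) * Cconj (u1 / u0))); [ring|].
  rewrite <- F; field; auto.
Qed.

Lemma Im_neq0_not_parallel (u v : C) : u <> 0 -> Im (v / u) <> 0%R -> ~ parallel u v.
Proof.
  intros Hu HI P; destruct (parallel_real u v Hu P) as [r ->].
  apply HI; replace (RtoC r * u / u) with (RtoC r) by (field; auto); reflexivity.
Qed.

Lemma config_homothetic V x y z : is_space V -> config V x y z -> distinct_Re x y z ->
  Im (z * (1 - x * y) / (x - z)) <> 0%R ->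
  homothetic V (QQ (z * (1 - x * y) / (x - z))).
Proof.
  intros HV HC HD HI.
  destruct (config_ratio _ _ _ _ HV HC HD) as (u & v & Hu & Hv & H0 & E).
  rewrite <- E in *; apply homothetic_basis; auto.
  now apply Im_neq0_not_parallel.
Qed.

(* Here [u1] is orthogonal to [u0], so that [V] is spanned by two vectors of
   equal length, mirror images of each other in the line of [u0]. *)
Lemma config_orthogonal V x y z : is_space V -> config V x y z -> distinct_Re x y z ->
  y * z = - (1) -> superrectangular V.
Proof.
  intros HV HC HD E.
  destruct (config_ratio _ _ _ _ HV HC HD) as (u & v & Vu & Vv & H0 & F).
  destruct (config_products_neq _ _ _ _ HC HD) as
    (Nxy & _ & _ & _ & Dxz & _ & X0 & _ & Z0).
  destruct HC as (Hx & _ & Hz & _).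
  assert (Hxz : x - z <> 0) by (intros G; apply Dxz, Cminus_eq0, G).
  assert (Hv : v = (x + z) / (x - z) * u).
  { replace v with (v / u * u) by (field; auto); rewrite F.
    replace (z * (1 - x * y)) with (x + z); auto.
    transitivity (z - x * (y * z)); [rewrite E; ring|ring]. }
  assert (Huv : u + v <> 0).
  { rewrite Hv; replace (u + (x + z) / (x - z) * u) with (2 * x * u / (x - z)) by (field; auto).
    repeat apply Cmult_neq_0; auto; [apply RtoC_neq0; lra|now apply Cinv_neq0]. }
  (* The sum and the difference are [2 x u / (x - z)] and [2 z u / (x - z)], so their ratio is the
     root of unity [z / x]. *)
  assert (G : (v - u) / (u + v) = z * Cconj x).
  { apply root_of_unity_unit in Hx as Ex.
    apply (Cmult_cancel_unit (u + v)); auto.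
    transitivity (v - u); [field; auto|].
    transitivity (2 * z * u / (x - z) * 1); [rewrite Hv; field; auto|].
    rewrite <- Ex, Hv; field; auto. }
  exists (z * Cconj x); split.
  { apply root_of_unity_mult; auto; now apply root_of_unity_conj. }
  rewrite <- G; apply homothetic_basis; auto.
  - apply HV; auto.
  - destruct HV as [(_ & Va & Vs) _]; apply Va; auto.
    replace (- u) with (RtoC (-1) * u) by (apply C_eq_iff; simpl; lra).
    apply Vs; auto with rat.
  (* A real [z / x] would give [z = x] or [z = -x]; the latter implies [x y = - y z = 1]. Both
     contradict the distinctness of the real parts. *)
  - apply Im_neq0_not_parallel; auto; rewrite G; intros HI.
    apply root_of_unity_unit in Hx, Hz.
    assert (R : z * Cconj x = Cconj z * x).
    { rewrite <- (Cconj_conj x) at 2; rewrite <- Cmult_conj.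
      apply C_eq_iff; rewrite im_conj, re_conj, HI; split; auto; lra. }
    assert (S : (z - x) * (z + x) = 0).
    { transitivity (z * z * (x * Cconj x) - x * x * (z * Cconj z)); [rewrite Hx, Hz; ring|].
      transitivity (z * x * (z * Cconj x - Cconj z * x)); [ring|rewrite R; ring]. }
    apply Cmult_integral in S; destruct S as [S|S].
    + apply Dxz; symmetry; now apply Cminus_eq0.
    + apply Nxy; replace x with (- z) by (symmetry; apply Cminus_eq0; rewrite <- S; ring).
      transitivity (- (y * z)); [ring|rewrite E; ring].
Qed.

(** Opposite real parts mean [y = -z] or [y z = -1]. The first case becomes the second after
    conjugating [x] and [z]. *)
Lemma config_opposite V x y z : is_space V -> config V x y z -> distinct_Re x y z ->
  Re y = (- Re z)%R -> superrectangular V.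
Proof.
  intros HV HC HD E; destruct HC as (Hx & Hy & Hz & HC').
  assert (HC : config V x y z) by (repeat split; auto).
  apply root_of_unity_unit in Hx, Hy, Hz.
  assert (Hz' : (- z) * Cconj (- z) = 1) by (rewrite Copp_conj; rewrite <- Hz; ring).
  destruct (unit_Re_eq y (- z) Hy Hz') as [F|F]; [simpl; exact E| |].
  - apply (config_orthogonal V (Cconj x) y (Cconj z)); auto.
    + now apply config_conj_xz.
    + rewrite F; transitivity (- (z * Cconj z)); [ring|rewrite Hz; ring].
  - apply (config_orthogonal V x y z); auto.
    transitivity (- (y * - z)); [ring|rewrite F; ring].
Qed.

(** * The two dodecagonal spaces *)

Lemma unit_coords (x : C) : x * Cconj x = 1 -> (Re x * Re x + Im x * Im x = 1)%R.
Proof. intros E; apply (f_equal Re) in E; simpl in E; unfold Re, Im; lra. Qed.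

Lemma square_eq (a b : R) : (a * a = b * b)%R -> a = b \/ a = (- b)%R.
Proof.
  intros E; destruct (Rmult_integral (a - b) (a + b)) as [H|H]; [lra|left|right]; lra.
Qed.

Lemma sqrt3_sqr : (sqrt 3 * sqrt 3 = 3)%R.
Proof. apply sqrt_sqrt; lra. Qed.

Lemma sqrt3_bounds : (1 < sqrt 3 < 2)%R.
Proof. pose proof sqrt3_sqr; pose proof (sqrt_pos 3); split; nra. Qed.

Lemma config_homothetic_eq V x y z tau : is_space V -> config V x y z ->
  distinct_Re x y z -> z * (1 - x * y) = tau * (x - z) -> Im tau <> 0%R ->
  homothetic V (QQ tau).
Proof.
  intros HV HC HD E HI.
  assert (Hxz : x - z <> 0).
  { intros F; apply (proj1 (proj2 HD)); now rewrite (Cminus_eq0 _ _ F). }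
  assert (F : z * (1 - x * y) / (x - z) = tau) by (rewrite E; field; auto).
  rewrite <- F in *; now apply config_homothetic.
Qed.

(** The real parts leave only the signs of [Im x] and [Im y] open. Roots can be conjugated in pairs,
    and conjugation fixes the real root [z], so both signs can be adjusted independently to reach
    [base], where the ratio of [config_ratio] is [tau1]. *)
Lemma config_tau1 V x y z : is_space V -> config V x y z ->
  Re x = (1 / 2)%R -> Re y = 0%R -> Re z = 1%R -> homothetic V (QQ tau1).
Proof.
  intros HV.
  assert (base : forall x y z, config V x y z ->
    Re x = (1 / 2)%R -> Re y = 0%R -> Re z = 1%R ->
    Im x = (- (sqrt 3 / 2))%R -> Im y = 1%R -> Im z = 0%R -> homothetic V (QQ tau1)).
  { clear x y z; intros x y z HC Rx Ry Rz Ix Iy Iz.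
    pose proof sqrt3_sqr as S; pose proof sqrt3_bounds as B.
    apply (config_homothetic_eq V x y z); auto.
    - repeat split; lra.
    - destruct x, y, z; unfold tau1; apply C_eq_iff; simpl in *; subst; split; nra.
    - unfold tau1; simpl; lra. }
  intros HC Rx Ry Rz.
  destruct HC as (Hx & Hy & Hz & HC').
  assert (HC : config V x y z) by (repeat split; auto).
  apply root_of_unity_unit, unit_coords in Hx, Hy, Hz.
  rewrite Rx in Hx; rewrite Ry in Hy; rewrite Rz in Hz.
  pose proof sqrt3_sqr as S.
  assert (Iz : Im z = 0%R) by nra.
  destruct (square_eq (Im x) (sqrt 3 / 2)) as [Ix|Ix]; [lra| |];
    destruct (square_eq (Im y) 1) as [Iy|Iy]; try lra.
  - apply (base (Cconj x) y (Cconj z)); auto; rewrite ?im_conj; try lra.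
    now apply config_conj_xz.
  - apply (base (Cconj x) (Cconj y) z); auto; rewrite ?im_conj; try lra.
    now apply config_swap_yz, config_conj_xz, config_swap_yz.
  - apply (base x y z); auto.
  - apply (base x (Cconj y) (Cconj z)); auto; rewrite ?im_conj; try lra.
    now apply config_conj_yz.
Qed.

(** As for [tau1], with [y] now the real root; the order of the roots is the one for which the ratio
    comes out as [tau2]. *)
Lemma config_tau2 V x y z : is_space V -> config V x y z ->
  Re x = (- (1 / 2))%R -> Re y = 1%R -> Re z = 0%R -> homothetic V (QQ tau2).
Proof.
  intros HV.
  assert (base : forall x y z, config V x y z ->
    Re x = (- (1 / 2))%R -> Re y = 1%R -> Re z = 0%R ->
    Im x = (sqrt 3 / 2)%R -> Im y = 0%R -> Im z = (- (1))%R -> homothetic V (QQ tau2)).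
  { clear x y z; intros x y z HC Rx Ry Rz Ix Iy Iz.
    pose proof sqrt3_sqr as S; pose proof sqrt3_bounds as B.
    apply (config_homothetic_eq V x y z); auto.
    - repeat split; lra.
    - destruct x, y, z; unfold tau2; apply C_eq_iff; simpl in *; subst; split; nra.
    - unfold tau2; simpl; lra. }
  intros HC Rx Ry Rz.
  destruct HC as (Hx & Hy & Hz & HC').
  assert (HC : config V x y z) by (repeat split; auto).
  apply root_of_unity_unit, unit_coords in Hx, Hy, Hz.
  rewrite Rx in Hx; rewrite Ry in Hy; rewrite Rz in Hz.
  pose proof sqrt3_sqr as S.
  assert (Iy : Im y = 0%R) by nra.
  destruct (square_eq (Im x) (sqrt 3 / 2)) as [Ix|Ix]; [lra| |];
    destruct (square_eq (Im z) 1) as [Iz|Iz]; try lra.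
  - apply (base x (Cconj y) (Cconj z)); auto; rewrite ?im_conj; try lra.
    now apply config_conj_yz.
  - apply (base x y z); auto.
  - apply (base (Cconj x) y (Cconj z)); auto; rewrite ?im_conj; try lra.
    now apply config_conj_xz.
  - apply (base (Cconj x) (Cconj y) z); auto; rewrite ?im_conj; try lra.
    now apply config_swap_yz, config_conj_xz, config_swap_yz.
Qed.

(** Negating all three roots preserves the configuration, so only the sign of [Re x * Re z] matters:
    positive gives [tau1], negative [tau2]. *)
Lemma config_dodecagonal V x y z : is_space V -> config V x y z ->
  (4 * (Re x * Re x) = 1)%R -> Re y = 0%R -> (Re z * Re z = 1)%R ->
  homothetic V (QQ tau1) \/ homothetic V (QQ tau2).
Proof.
  intros HV HC Hx Hy Hz; pose proof (config_opp _ _ _ _ HC) as HC'.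
  destruct (square_eq (Re x) (1 / 2)) as [Ex|Ex]; [lra| |];
    (destruct (square_eq (Re z) 1) as [Ez|Ez]; [lra| |]).
  - left; now apply (config_tau1 V x y z).
  - right; apply config_swap_yz in HC'; apply (config_tau2 _ _ _ _ HV HC'); simpl in *;
      unfold Re in *; lra.
  - right; apply config_swap_yz in HC; apply (config_tau2 _ _ _ _ HV HC); lra.
  - left; apply (config_tau1 _ _ _ _ HV HC'); simpl in *; unfold Re in *; lra.
Qed.

(** * Classification of configurations *)

Lemma root_of_unity_pow_mult x n m : Cpow x n = 1 -> Cpow x (n * m) = 1.
Proof. intros E; now rewrite Cpow_mult_r, E, Cpow_1_l. Qed.

Lemma common_exponent x y z : root_of_unity x -> root_of_unity y -> root_of_unity z ->
  exists n, (0 < n)%nat /\ Cpow x n = 1 /\ Cpow y n = 1 /\ Cpow z n = 1.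
Proof.
  intros (i & Hi & Ei) (j & Hj & Ej) (k & Hk & Ek).
  exists (i * j * k)%nat; split; [nia|repeat split].
  - now rewrite <- Nat.mul_assoc; apply root_of_unity_pow_mult.
  - replace (i * j * k)%nat with (j * (i * k))%nat by ring.
    now apply root_of_unity_pow_mult.
  - rewrite Nat.mul_comm; now apply root_of_unity_pow_mult.
Qed.

Definition dodecagonal (V : C -> Prop) : Prop :=
  homothetic V (QQ tau1) \/ homothetic V (QQ tau2).

Lemma config_classification V x y z :
  is_space V -> config V x y z -> distinct_Re x y z -> superrectangular V \/ dodecagonal V.
Proof.
  intros HV HC HD.
  destruct (config_relation _ _ _ _ HV HC HD) as
    (p & q & r & Hp & Hq & Hr & Np & Nq & Nr & pqr & rel).
  destruct (common_denominator p q r Hp Hq Hr) as (k & p' & q' & r' & Nk & Ep & Eq & Er).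
  assert (nz : forall (s : R) (s' : Z), s <> 0%R -> IZR s' = (k * s)%R -> s' <> 0%Z).
  { intros s s' Hs E ->; apply Hs; apply (Rmult_eq_reg_l k); auto; rewrite <- E; ring. }
  destruct HC as (Hx & Hy & Hz & HC').
  destruct (common_exponent x y z Hx Hy Hz) as (n & Hn & Xn & Yn & Zn).
  assert (HC : config V x y z) by (repeat split; auto).
  pose proof HD as (Dxy & Dxz & Dyz).
  assert (sq_yz : (Re y * Re y = Re z * Re z)%R -> superrectangular V).
  { intros E; apply (config_opposite V x y z); auto.
    destruct (square_eq _ _ E); [contradiction|auto]. }
  assert (sq_xz : (Re x * Re x = Re z * Re z)%R -> superrectangular V).
  { intros E; apply (config_opposite V y x z); auto using config_swap_xy.
    - repeat split; auto.
    - destruct (square_eq _ _ E); [contradiction|auto]. }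
  assert (sq_xy : (Re x * Re x = Re y * Re y)%R -> superrectangular V).
  { intros E; apply (config_opposite V z x y); auto using config_swap_yz, config_swap_xz.
    - repeat split; auto.
    - destruct (square_eq _ _ E); [contradiction|auto]. }
  destruct (CosineRelation.cosine_relation_R Hn Xn Yn Zn (nz _ _ Np Ep) (nz _ _ Nq Eq)
    (nz _ _ Nr Er)) as [[E|E|E]|small].
  - apply eq_IZR; rewrite !plus_IZR, Ep, Eq, Er; rewrite <- !Rmult_plus_distr_l, pqr; ring.
  - rewrite Ep, Eq, Er.
    transitivity (k * (p * Re x + q * Re y + r * Re z))%R; [unfold Re; ring|].
    rewrite rel; apply Rmult_0_r.
  - left; exact (sq_xy E).
  - left; exact (sq_xz E).
  - left; exact (sq_yz E).
  - pose proof (small x (or_introl eq_refl)) as Sx.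
    pose proof (small y (or_intror (or_introl eq_refl))) as Sy.
    pose proof (small z (or_intror (or_intror eq_refl))) as Sz.
    fold (Re x) in Sx; fold (Re y) in Sy; fold (Re z) in Sz.
    assert (four : forall a : R, ((a + a) * (a + a) = 1)%R -> (4 * (a * a) = 1)%R).
    { intros a E; rewrite <- E; ring. }
    assert (zero : forall a b : R, a = 0%R -> b = 0%R -> (a * a = b * b)%R).
    { intros a b -> ->; reflexivity. }
    (* Of the 27 combinations, those with a repeated absolute value are superrectangular; the other
       six are the orderings of 0, 1/2, 1. *)
    destruct Sx as [Sx|[Sx|Sx]], Sy as [Sy|[Sy|Sy]], Sz as [Sz|[Sz|Sz]];
      try (left; apply sq_xy; auto; lra); try (left; apply sq_xz; auto; lra);
      try (left; apply sq_yz; auto; lra); right; unfold dodecagonal.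
    + apply (config_dodecagonal V y x z); auto using config_swap_xy.
    + apply (config_dodecagonal V z x y); auto using config_swap_yz, config_swap_xz.
    + apply (config_dodecagonal V x y z); auto.
    + apply (config_dodecagonal V x z y); auto using config_swap_yz.
    + apply (config_dodecagonal V z y x); auto using config_swap_xz.
    + apply (config_dodecagonal V y z x); auto using config_swap_yz, config_swap_xy.
Qed.

(** * From rational angles to configurations *)

Definition cis (t : R) : C := (cos t, sin t).

Lemma cis_add s t : cis (s + t) = cis s * cis t.
Proof. apply C_eq_iff; simpl; rewrite cos_plus, sin_plus; lra. Qed.

Lemma cis_conj t : Cconj (cis t) = cis (- t).
Proof. apply C_eq_iff; simpl; rewrite cos_neg, sin_neg; lra. Qed.

Lemma cis_pow t n : Cpow (cis t) n = cis (INR n * t).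
Proof.
  induction n as [|n IH].
  - simpl; rewrite Rmult_0_l; apply C_eq_iff; simpl; rewrite cos_0, sin_0; lra.
  - rewrite S_INR, Rmult_plus_distr_r, Rmult_1_l, Rplus_comm, cis_add, <- IH; reflexivity.
Qed.

Lemma cis_rat_root_of_unity q : is_rat q -> root_of_unity (cis (q * PI)).
Proof.
  intros Hq; destruct (is_rat_frac _ Hq) as (a & b & ->).
  (* Multiplication by [2 b] turns the angle [a PI / b] into the full turns [2 a PI]. *)
  exists (2 * Pos.to_nat b)%nat; split; [lia|].
  rewrite cis_pow, mult_INR, INR_IPR.
  assert (Hb : IZR (Zpos b) <> 0%R) by now apply not_0_IZR.
  replace (INR 2 * IPR b * (IZR a / IZR (Zpos b) * PI))%R with (0 + 2 * IZR a * PI)%R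
    by (change (IPR b) with (IZR (Zpos b)); simpl; field; auto).
  assert (P : cos (0 + 2 * IZR a * PI) = 1%R /\ sin (0 + 2 * IZR a * PI) = 0%R).
  { destruct (Z.le_gt_cases 0 a) as [Ha|Ha].
    - rewrite <- (Z2Nat.id a Ha), <- INR_IZR_INZ, cos_period, sin_period.
      split; [apply cos_0|apply sin_0].
    - replace (0 + 2 * IZR a * PI)%R with (- (0 + 2 * INR (Z.to_nat (- a)) * PI))%R.
      + rewrite cos_neg, sin_neg, cos_period, sin_period, cos_0, sin_0; split; lra.
      + rewrite INR_IZR_INZ, Z2Nat.id, opp_IZR by lia; ring. }
  destruct P as [Pc Ps]; apply C_eq_iff; simpl; auto.
Qed.

(** The quotient of [v i * Cconj (v O)] by its conjugate is [exp(2 i q PI)], where [q PI] is the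
    argument of [v i / v O]. Lengths cancel, and the doubled angle depends on the two lines only. *)
Lemma rational_4tuple_config V v : is_space V -> rational_4tuple V v ->
  exists x y z, config V x y z /\ distinct_Re x y z.
Proof.
  intros HV (Hv & Hp & Hr).
  assert (dir : forall i, (0 < i < 4)%nat -> exists q, is_rat q /\
    v i * Cconj (v O) = cis (2 * (q * PI)) * (Cconj (v i) * v O)).
  { intros i Hi; destruct (Hr O i) as (q & Hq & E); [lia|lia|lia|].
    exists q; split; auto; unfold is_arg in E.
    destruct (Hv O) as [_ H0]; [lia|]; pose proof (Cconj_neq0 _ H0).
    set (m := Cmod (v i / v O)) in *.
    assert (E' : v i = RtoC m * cis (q * PI) * v O).
    { replace (v i) with (v i / v O * v O) by (field; auto); rewrite E at 1; f_equal.
      f_equal; apply C_eq_iff; simpl; lra. }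
    rewrite E', !Cmult_conj, Cconj_RtoC, cis_conj.
    replace (2 * (q * PI))%R with (q * PI + q * PI)%R by ring; rewrite cis_add.
    transitivity (RtoC m * cis (q * PI) * v O * Cconj (v O) * (cis (q * PI) * cis (- (q * PI)))).
    2: ring.
    rewrite <- cis_add, Rplus_opp_r.
    replace (cis 0) with (RtoC 1) by (apply C_eq_iff; simpl; rewrite cos_0, sin_0; auto).
    ring. }
  destruct (dir 1%nat) as (q1 & Q1 & E1); [lia|].
  destruct (dir 2%nat) as (q2 & Q2 & E2); [lia|].
  destruct (dir 3%nat) as (q3 & Q3 & E3); [lia|].
  (* The angles are chosen so that [y z], [x z], [x y] have angles [2 q1 PI], [2 q2 PI],
     [2 q3 PI]. *)
  set (x := cis ((q2 + q3 - q1) * PI)); set (y := cis ((q1 + q3 - q2) * PI)).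
  set (z := cis ((q1 + q2 - q3) * PI)).
  assert (Hx : root_of_unity x) by (apply cis_rat_root_of_unity; auto with rat).
  assert (Hy : root_of_unity y) by (apply cis_rat_root_of_unity; auto with rat).
  assert (Hz : root_of_unity z) by (apply cis_rat_root_of_unity; auto with rat).
  replace (cis (2 * (q1 * PI))) with (y * z) in E1
    by (unfold y, z; rewrite <- cis_add; f_equal; ring).
  replace (cis (2 * (q2 * PI))) with (x * z) in E2
    by (unfold x, z; rewrite <- cis_add; f_equal; ring).
  replace (cis (2 * (q3 * PI))) with (x * y) in E3
    by (unfold x, y; rewrite <- cis_add; f_equal; ring).
  exists x, y, z; split.
  { repeat split; auto; exists (v O), (v 1%nat), (v 2%nat), (v 3%nat).
    do 4 (split; [apply Hv; lia|]); auto. }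
  destruct (Hv O) as [_ H0]; [lia|].
  destruct (Hv 1%nat) as [_ H1]; [lia|]; destruct (Hv 2%nat) as [_ H2]; [lia|].
  pose proof (Cconj_neq0 _ H0) as H0'.
  assert (np : forall i j, (i < 4)%nat -> (j < 4)%nat -> i <> j -> ~ parallel (v i) (v j)).
  { intros i j Hi Hj Hij P; apply (Hp i j Hi Hj Hij); apply parallel_real; auto.
    now apply Hv. }
  assert (par0 : forall u e, u * Cconj (v O) = e * (Cconj u * v O) -> e = 1 -> parallel (v O) u).
  { intros u e E ->; unfold parallel; symmetry; rewrite Cmult_comm, E; ring. }
  assert (par : forall u w e, u * Cconj (v O) = e * (Cconj u * v O) ->
    w * Cconj (v O) = e * (Cconj w * v O) -> parallel u w).
  { intros u w e Eu Ew; unfold parallel.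
    apply (Cmult_cancel_unit (Cconj (v O) * v O)); [now apply Cmult_neq_0|].
    transitivity (u * Cconj (v O) * (Cconj w * v O)); [ring|].
    rewrite Eu; transitivity (Cconj u * v O * (e * (Cconj w * v O))); [ring|].
    rewrite <- Ew; ring. }
  apply root_of_unity_unit in Hx, Hy, Hz.
  (* Each equality of real parts makes two lines coincide: for instance [x = y] identifies those of
     [v 1] and [v 2], and [x y = 1] those of [v 0] and [v 3]. *)
  repeat split; intros E; apply unit_Re_eq in E; auto; destruct E as [E|E].
  - apply (np 1%nat 2%nat); [lia|lia|lia|]; apply (par _ _ (x * z)); auto.
    now rewrite E1, E.
  - apply (np 0%nat 3%nat); [lia|lia|lia|]; exact (par0 _ _ E3 E).
  - apply (np 1%nat 3%nat); [lia|lia|lia|]; apply (par _ _ (x * y)); auto.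
    rewrite E1, E; ring.
  - apply (np 0%nat 2%nat); [lia|lia|lia|]; exact (par0 _ _ E2 E).
  - apply (np 2%nat 3%nat); [lia|lia|lia|]; apply (par _ _ (x * y)); auto.
    rewrite E2, E; ring.
  - apply (np 0%nat 1%nat); [lia|lia|lia|]; exact (par0 _ _ E1 E).
Qed.

Lemma homothetic_refl V : homothetic V V.
Proof.
  exists 1; split; [apply RtoC_neq0; lra|]; intros z; split.
  - intros Hz; exists z; split; auto; ring.
  - intros (w & Hw & ->); replace (1 * w) with w by ring; auto.
Qed.

Theorem theorem7p3 (V : C -> Prop) :
  is_space V ->
  (exists v : nat -> C, rational_4tuple V v) ->
  (exists W : C -> Prop, is_space W /\ superrectangular W /\ homothetic V W) \/
  homothetic V (QQ tau1) \/ homothetic V (QQ tau2).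
Proof.
  intros HV [v Hv].
  destruct (rational_4tuple_config V v HV Hv) as (x & y & z & HC & HD).
  destruct (config_classification V x y z HV HC HD) as [HS|HT]; [left|now right].
  (* [superrectangular] already allows a homothety, so [V] itself serves as [W]. *)
  exists V; auto using homothetic_refl.
Qed.
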